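(* Let $D$ be an infinite discrete subset of $S=SL_n(\mathbb{C})$. Then $D$ is tame if and only if there exist a connected one-dimensional complex algebraic subgroup $A$ of $S$ and an automorphism $\phi$ of the complex manifold $S$ such that $\phi(D)\subset A$.
   Context: A discrete subset of a complex manifold $X$ is a subset without accumulation points in $X$. An automorphism of $X$ is a biholomorphic self-map of the complex manifold $X$ (not necessarily a group homomorphism when $X$ is a Lie group). An exhaustion function on $X$ is a continuous function $\rho:X\to\mathbb{R}^+$ (non-negative reals) all of whose sublevel sets $\{x\in X:\rho(x)\le c\}$ are compact. An infinite discrete subset $D\subset X$ is called tame if for every exhaustion function $\rho:X\to\mathbb{R}^+$ and every map $\zeta:D\to\mathbb{R}^+$ there exists an automorphism $\phi$ of $X$ such that $\rho(\phi(x))\ge\zeta(x)$ for all $x\in D$. *)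

(* Defs.v *)
From HB Require Import structures.
From mathcomp Require Import all_boot all_order all_algebra.
From mathcomp Require Import complex.
From mathcomp Require mpoly.
From mathcomp Require Import all_classical all_reals all_analysis.

Set Implicit Arguments.
Unset Strict Implicit.
Unset Printing Implicit Defensive.

Import Order.TTheory GRing.Theory Num.Theory.
Import numFieldNormedType.Exports.

Local Open Scope classical_set_scope.
Local Open Scope ring_scope.
Local Open Scope complex_scope.

(* Canonical norm and topology of C as a normed space over itself. *)
HB.instance Definition _ (R : realType) := NormedModule.copy R[i] (R[i])^o.

(* Closed complex submanifolds are represented by their underlying set [X] in
   an ambient normed complex vector space; maps on [X] are ambient maps of which
   only the values on [X] matter. *)

Section Submanifolds.
Context {R : realType}.

(* [f] restricted to [X] is, near each point of [X], the restriction of an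
   ambient map that is complex differentiable on a neighbourhood. *)
Definition holomorphic_on {V W : normedModType R[i]} (X : set V) (f : V -> W) :=
  forall x, X x -> exists F : V -> W,
    (\forall y \near x, differentiable F y) /\
    (\forall y \near x, X y -> f y = F y).

Definition automorphism {V : normedModType R[i]} (X : set V) (f : V -> V) :=
  exists g : V -> V,
    [/\ set_fun X X f, set_fun X X g,
        {in X, cancel f g}, {in X, cancel g f} &
        holomorphic_on X f /\ holomorphic_on X g].

Definition exhaustion {V : normedModType R[i]} (X : set V) (rho : V -> R) :=
  [/\ {within X, continuous rho},
      forall x, X x -> 0 <= rho x &
      forall c : R, compact (X `&` [set x | rho x <= c])].

Definition discrete_in {V : normedModType R[i]} (X D : set V) :=
  D `<=` X /\ X `&` limit_point D = set0.

(* Meant for infinite [D] with [discrete_in X D]. *)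
Definition tame {V : normedModType R[i]} (X D : set V) :=
  forall (rho zeta : V -> R), exhaustion X rho ->
    (forall x, D x -> 0 <= zeta x) ->
    exists phi : V -> V,
      automorphism X phi /\ forall x, D x -> zeta x <= rho (phi x).

End Submanifolds.

Section AlgebraicSubsets.
Context {K : fieldType} {n : nat}.

Definition SL : set 'M[K]_n := [set M | \det M = 1].

Definition zariski_closed (Z : set 'M[K]_n) :=
  exists P : set (mpoly.mpoly (n * n) K),
    Z = [set M | forall p, P p -> mpoly.meval (fun k => mxvec M 0 k) p = 0].

Definition algebraic_subgroup (A : set 'M[K]_n) :=
  [/\ zariski_closed A, A `<=` SL, A 1%:M,
      forall M N, A M -> A N -> A (M *m N) &
      forall M, A M -> A (invmx M)].

Definition zariski_connected (A : set 'M[K]_n) :=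
  A !=set0 /\
  forall Z1 Z2, zariski_closed Z1 -> zariski_closed Z2 ->
    A `<=` Z1 `|` Z2 -> A `&` Z1 `&` Z2 = set0 -> A `<=` Z1 \/ A `<=` Z2.

Definition zariski_irreducible (A : set 'M[K]_n) :=
  A !=set0 /\
  forall Z1 Z2, zariski_closed Z1 -> zariski_closed Z2 ->
    A `<=` Z1 `|` Z2 -> A `<=` Z1 \/ A `<=` Z2.

(* Z 0 < Z 1 < ... < Z d, irreducible closed subsets of A *)
Definition krull_chain (A : set 'M[K]_n) (d : nat) (Z : nat -> set 'M[K]_n) :=
  (forall i, (i <= d)%N ->
     [/\ zariski_closed (Z i), zariski_irreducible (Z i) & Z i `<=` A]) /\
  (forall i, (i < d)%N -> Z i `<` Z i.+1).

Definition krull_dim (A : set 'M[K]_n) (d : nat) :=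
  (exists Z, krull_chain A d Z) /\
  (forall m Z, krull_chain A m Z -> (m <= d)%N).

End AlgebraicSubsets.

Arguments SL : clear implicits.

(* Main.v *)
Require Import Defs.
From mathcomp Require Import all_boot all_order all_algebra.
From mathcomp Require Import complex closed_field.
From mathcomp Require mpoly.
From mathcomp Require Import all_classical all_reals all_analysis.
From mathcomp Require Import zify ring lra.
Import (canonicals, coercions) mpoly.

Set Implicit Arguments.
Unset Strict Implicit.
Unset Printing Implicit Defensive.

Import Order.TTheory GRing.Theory Num.Theory.
Import numFieldNormedType.Exports.
Local Open Scope classical_set_scope.
Local Open Scope ring_scope.
Local Open Scope complex_scope.

(** Both directions rest on one principle. Let [g k] be a sequence in SL and
    suppose that a rank-one functional [M |-> u M v] takes at the [g k] values
    [z k] that are nonzero, pairwise distinct and tend to infinity. A constant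
    change of coordinates turns the functional into the corner entry [M 0 0].
    The maps [M |-> A(M 0 0) M B(M 0 0)], where [A] and [B] are entire with
    values in SL and the multiplications do not touch the corner, are
    automorphisms of SL. Entire functions take arbitrary values at the [z k]
    ([entire_interpolation]), and so do entire maps into SL, because matrices
    in SL are products of unipotents with free entries ([SL_interpolation]).
    As the corner is the only invariant of the double coset
    ([pivot_double_coset]), the sequence can be moved to any sequence [h k] in
    SL with [h k 0 0 = z k] ([move_sequence]). One such sequence lies, up to a
    constant factor, in the unipotent subgroup of the matrices
    [1 + t * delta_mx 0 1]; another one goes to infinity as fast as one likes.

    If [D] is tame, an automorphism first spreads its points so much that a
    functional as above exists: there are constants [c k], known in advance,
    such that every sequence of matrices [M k] admits a functional of size at
    least [c k * mxabs (M k)] at [M k], for all [k] at once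
    ([generic_functional]). The principle then moves [D] into the unipotent
    subgroup, an irreducible algebraic curve.

    Conversely, let [D] lie in an algebraic set [A] of dimension one. Any two
    entries are algebraically dependent on [A]
    ([curve_coordinates_dependent]): otherwise, by quantifier
    elimination, an irreducible component would have an image in the plane that
    contains infinitely many points of some vertical line, while in dimension
    one its closed proper subsets are finite. The top homogeneous parts of these
    relations leave finitely many directions in which [A] goes to infinity
    ([curve_directions]), and a functional that is nonzero on these directions
    is proper on [A] ([curve_proper_functional]). It can be taken injective on
    [D], so that the principle sends [D] to infinity at any prescribed speed. *)

(** * Noetherianity of the Zariski topology *)

Lemma nondecreasing_subseq (f : nat -> nat) :
  exists s : nat -> nat,
    {homo s : i j / (i < j)%N} /\ {homo (f \o s) : i j / (i <= j)%N}.
Proof.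
have argmin N : exists k, (N <= k)%N /\ forall l, (N <= l)%N -> (f k <= f l)%N.
  pose P v := `[< exists k, (N <= k)%N /\ f k = v >].
  have exP : exists v, P v by exists (f N); apply/asboolP; exists N.
  case: (ex_minnP exP) => v /asboolP [k [Nk <-]] min_v; exists k; split => // l Nl.
  by apply: min_v; apply/asboolP; exists l.
have [g gP] := choice argmin.
(* each index minimizes [f] beyond the previous one *)
pose s := fix s k := if k is k'.+1 then g (s k').+1 else g 0.
have sS k : (s k < s k.+1)%N by have [] := gP (s k).+1.
exists s; split; first exact: (homo_ltn ltn_trans sS).
apply: (homo_leq (@leqnn) (@leq_trans)) => k /=.
case: k => [|k] /=; first by have [_] := gP 0; apply.
have [lt_k min_k] := gP (s k).+1; apply: min_k.
by have := (gP (g (s k).+1).+1).1; lia.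
Qed.

(** Dickson's lemma, by extracting subsequences one variable at a time. *)
Lemma dickson n (m : nat -> mpoly.multinom n) :
  exists i j, (i < j)%N /\ mpoly.lem (m i) (m j).
Proof.
suff sub k : (k <= n)%N -> exists s : nat -> nat, {homo s : i j / (i < j)%N} /\
    forall c : 'I_n, (c < k)%N ->
      {homo (fun i => mpoly.fun_of_multinom (m (s i)) c) : i j / (i <= j)%N}.
  have [s [s_mono m_mono]] := sub n (leqnn n).
  exists (s 0), (s 1); split; first exact: s_mono.
  by apply/mpoly.mnm_lepP => c; apply: m_mono.
elim: k => [|k IH] le_kn; first by exists id; split.
have [s [s_mono m_mono]] := IH (ltnW le_kn).
have [t [t_mono mt_mono]] := nondecreasing_subseq
  (fun i => mpoly.fun_of_multinom (m (s i)) (Ordinal le_kn)).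
exists (s \o t); split => [i j /t_mono /s_mono //|c].
rewrite ltnS leq_eqVlt => /orP[/eqP eq_ck|lt_ck] i j le_ij.
  by have := mt_mono i j le_ij; rewrite (_ : Ordinal _ = c) //; apply: val_inj.
by apply: m_mono => //; move: le_ij; rewrite leq_eqVlt => /orP[/eqP->//|/t_mono/ltnW].
Qed.

Section Zariski.
Context {K : fieldType} {n : nat}.
Implicit Types (Z : set 'M[K]_n) (p q : mpoly.mpoly (n * n) K).

Definition mxeval (M : 'M[K]_n) p := mpoly.meval (fun k => mxvec M 0 k) p.

Definition zeros (P : set (mpoly.mpoly (n * n) K)) : set 'M[K]_n :=
  [set M | forall p, P p -> mxeval M p = 0].

Lemma mxevalB M p q : mxeval M (p - q) = mxeval M p - mxeval M q.
Proof. exact: mpoly.mevalB. Qed.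

Lemma mxevalM M p q : mxeval M (p * q) = mxeval M p * mxeval M q.
Proof. exact: mpoly.mevalM. Qed.

Lemma exists_minimal_mlead (Q : set (mpoly.mpoly (n * n) K)) : Q !=set0 ->
  exists p, Q p /\ forall q, Q q -> ~ (mpoly.mlead q < mpoly.mlead p)%O.
Proof.
move=> [p0 Qp0]; apply: contrapT => no_min; move: Qp0.
elim/mpoly.mleadrect: p0 => p IH Qp; apply: no_min; exists p; split => // q Qq lt_qp.
exact: IH lt_qp Qq.
Qed.

(** The division step of Groebner basis theory: a multiple of [q] by a monomial
    removes the leading term of [p]. *)
Lemma cancel_mlead p q : p != 0 -> q != 0 ->
    mpoly.lem (mpoly.mlead q) (mpoly.mlead p) ->
  exists r, p - r * q = 0 \/ (mpoly.mlead (p - r * q) < mpoly.mlead p)%O.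
Proof.
move=> p0 q0 le_qp.
have lp0 : mpoly.mcoeff (mpoly.mlead p) p != 0 by rewrite mpoly.mleadc_eq0.
have lq0 : mpoly.mcoeff (mpoly.mlead q) q != 0 by rewrite mpoly.mleadc_eq0.
pose m := mpoly.mnm_sub (mpoly.mlead p) (mpoly.mlead q).
pose c := mpoly.mcoeff (mpoly.mlead p) p / mpoly.mcoeff (mpoly.mlead q) q.
have c0 : c != 0 by rewrite mulf_neq0 ?invr_eq0.
pose X := mpoly.mpolyX K m.
have Xq : mpoly.mlead (X * q) = mpoly.mlead p.
  rewrite mpoly.mleadM_proper mpoly.mleadXm ?mpoly.submK //.
  by rewrite mpoly.mcoeffX eqxx mul1r.
have cXq : mpoly.mcoeff (mpoly.mlead p) (X * q) = mpoly.mcoeff (mpoly.mlead q) q.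
  by rewrite mulrC -(mpoly.submK le_qp) mpoly.mcoeffMX.
exists (c *: X); rewrite -scalerAl; set r := p - _.
have [-> | r0] := eqVneq r 0; [by left | right].
rewrite lt_neqAle; apply/andP; split.
  apply: contraNneq r0 => lead_r; rewrite -mpoly.mleadc_eq0 lead_r /r.
  by rewrite mpoly.mcoeffB mpoly.mcoeffZ cXq /c divfK // subrr.
apply: le_trans (mpoly.mleadB_le _ _) _.
by rewrite mpoly.mleadZ_proper Xq ?joinxx // cXq mulf_neq0.
Qed.

(** Hilbert's basis theorem in geometric form: choosing along the chain an
    equation of [Z i.+1] that fails on [Z i], of least leading monomial,
    Dickson's lemma makes one leading monomial divide a later one, and the
    division step contradicts the leastness of the latter. *)
Lemma zariski_dcc (Z : nat -> set 'M[K]_n) :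
  (forall i, zariski_closed (Z i)) -> (forall i, Z i.+1 `<` Z i) -> False.
Proof.
move=> Zc Zlt.
have Zdec i j : (i <= j)%N -> Z j `<=` Z i.
  elim: j => [|j IH]; first by rewrite leqn0 => /eqP->.
  rewrite leq_eqVlt => /orP[/eqP-> //|]; rewrite ltnS => /IH Zji.
  exact: subset_trans (properW (Zlt j)) Zji.
pose I i : set (mpoly.mpoly (n * n) K) := [set p | Z i `<=` [set M | mxeval M p = 0]].
pose Q i := I i.+1 `&` ~` I i.
have Q0 i : Q i !=set0.
  have [_ /existsNP [M /not_implyP [ZM nZM]]] := Zlt i.
  have [P PE] := Zc i.+1; move: nZM; rewrite PE => /existsNP [p /not_implyP [Pp pM]].
  exists p; split => [N|IpM]; last exact/pM/IpM.
  by rewrite PE; apply.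
have [f fP] := choice (fun i => exists_minimal_mlead (Q0 i)).
have f0 i : f i != 0.
  apply/eqP => fi0; have [[_ nI] _] := fP i; apply: nI => M _.
  by rewrite /mkset fi0 /mxeval mpoly.meval0.
have [i [j [lt_ij le_ij]]] := dickson (fun i => mpoly.mlead (f i)).
have [[If nIf] min_j] := fP j.
have Ifi : I j (f i).
  by have [[Ifi _] _] := fP i; apply: subset_trans (Zdec _ _ lt_ij) Ifi.
have [r []] := cancel_mlead (f0 j) (f0 i) le_ij.
  move/eqP; rewrite subr_eq0 => /eqP fjE; apply: nIf => M /Ifi fiM.
  by rewrite /mkset fjE mxevalM fiM mulr0.
apply: min_j; split.
  move=> M ZM; rewrite /mkset mxevalB mxevalM (If _ ZM).
  by rewrite (Ifi _ (Zdec _ _ (leqnSn j) _ ZM)) mulr0 subr0.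
move=> Ir; apply: nIf => M ZM; have := Ir M ZM.
by rewrite /mkset mxevalB mxevalM (Ifi _ ZM) mulr0 subr0.
Qed.

(** A failure could be repeated on ever smaller closed sets, and dependent
    choice would build a descending chain. *)
Lemma zariski_induction (P : set 'M[K]_n -> Prop) :
  (forall Z, zariski_closed Z ->
     (forall W, zariski_closed W -> W `<` Z -> P W) -> P Z) ->
  forall Z, zariski_closed Z -> P Z.
Proof.
move=> ind Z0 Z0c; apply: contrapT => nP.
pose T := {Z | zariski_closed Z /\ ~ P Z}.
have next (Z : T) : exists W : T, sval W `<` sval Z.
  case: Z => Z [Zc nPZ] /=; apply: contrapT => noW; apply/nPZ/ind => // W Wc WZ.
  by apply: contrapT => nPW; apply: noW; exists (exist _ W (conj Wc nPW)).
have [nx nxP] := choice next.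
pose s := fix s k : T := if k is k'.+1 then nx (s k') else exist _ Z0 (conj Z0c nP).
apply: (@zariski_dcc (fun k => sval (s k))) => k; first by case: (svalP (s k)).
exact: nxP.
Qed.

End Zariski.

(** * Zariski closed sets of dimension one *)

Section ZariskiClosed.
Context {K : fieldType} {n : nat}.
Implicit Types (Z W V : set 'M[K]_n).

Lemma zariski_closedU Z W :
  zariski_closed Z -> zariski_closed W -> zariski_closed (Z `|` W).
Proof.
move=> [P ->] [Q ->]; exists [set r | exists p q, [/\ P p, Q q & r = p * q]].
apply/seteqP; split => M /=.
  move=> PQ _ [p [q [Pp Qq ->]]]; rewrite [LHS](@mxevalM K n).
  case: PQ => [/(_ p Pp) M0|/(_ q Qq) M0].
    by rewrite [X in X * _]M0 mul0r.
  by rewrite [X in _ * X]M0 mulr0.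
move=> PQ; have [|] := pselect (zeros P M); first by left.
move=> /existsNP [p /not_implyP [Pp pM]]; right => q Qq.
have /eqP : mxeval M (p * q) = 0 by apply: PQ; exists p, q.
by rewrite mxevalM mulf_eq0 => /orP[/eqP|/eqP].
Qed.

Lemma zariski_closedI Z W :
  zariski_closed Z -> zariski_closed W -> zariski_closed (Z `&` W).
Proof.
move=> [P ->] [Q ->]; exists (P `|` Q); apply/seteqP; split => M /=.
  by move=> [PM QM] p [/PM|/QM].
by move=> PQ; split=> p ?; apply: PQ; [left | right].
Qed.

Lemma zariski_closed_zeros (P : set (mpoly.mpoly (n * n) K)) : zariski_closed (zeros P).
Proof. by exists P. Qed.

Lemma zariski_closed_level k (c : K) : zariski_closed [set M : 'M[K]_n | mxvec M 0 k = c].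
Proof.
exists [set mpoly.mpolyX K (mpoly.mnm1 k) - mpoly.mpolyC (n * n) c].
apply/seteqP; split => M /=.
  by move=> <- _ ->; rewrite mpoly.mevalB mpoly.mevalXU mpoly.mevalC subrr.
move=> /(_ _ erefl) /eqP.
by rewrite mpoly.mevalB mpoly.mevalXU mpoly.mevalC subr_eq0 => /eqP.
Qed.

Lemma zariski_closed_bigcap (I : Type) (Z : I -> set 'M[K]_n) :
  (forall i, zariski_closed (Z i)) -> zariski_closed (\bigcap_i Z i).
Proof.
move=> /choice [P ZP]; exists [set p | exists i, P i p].
apply/seteqP; split => M /=.
  by move=> ZM p [i Pp]; have := ZM i Logic.I; rewrite ZP; apply.
by move=> PM i _; rewrite ZP => p Pp; apply: PM; exists i.
Qed.

Lemma zariski_closed1 (M : 'M[K]_n) : zariski_closed [set M].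
Proof.
rewrite (_ : [set M] = \bigcap_k [set N | mxvec N 0 k = mxvec M 0 k]).
  by apply: zariski_closed_bigcap => k; apply: zariski_closed_level.
apply/seteqP; split => [N -> //|N eqNM].
by apply: (can_inj mxvecK); apply/rowP => k; apply: eqNM.
Qed.

(** By the descending chain condition, adding equations one at a time must
    stop. *)
Lemma zariski_closed_finite Z : zariski_closed Z ->
  exists s : seq (mpoly.mpoly (n * n) K), Z = zeros [set` s].
Proof.
move=> [P ZE]; apply: contrapT => noS.
pose T := {s : seq (mpoly.mpoly (n * n) K) | [set` s] `<=` P}.
have T0 : [set` [::] : seq (mpoly.mpoly (n * n) K)] `<=` P by move=> p; rewrite /= in_nil.
have next (s : T) : exists t : T, zeros [set` sval t] `<` zeros [set` sval s].
  case: s => s sP /=.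
  have Zs : Z `<=` zeros [set` s] by rewrite ZE => M PM p /sP; apply: PM.
  have [M [sM nZM]] : exists M, zeros [set` s] M /\ ~ Z M.
    apply: contrapT => noM; apply: noS; exists s; apply/seteqP; split => // M sM.
    by apply: contrapT => nZM; apply: noM; exists M.
  move: nZM; rewrite ZE => /existsNP [p /not_implyP [Pp pM]].
  have psP : [set` p :: s] `<=` P.
    by move=> q /=; rewrite in_cons => /orP[/eqP->|/sP].
  exists (exist _ (p :: s) psP) => /=; split => [N psN q qs|/(_ M sM) /(_ p)].
    by apply: psN; rewrite /= in_cons; move: qs => /= ->; rewrite orbT.
  by apply: contra_not pM => E; apply: E => /=; rewrite in_cons eqxx.
have [nx nxP] := choice next.
pose t := fix t k : T := if k is k'.+1 then nx (t k') else exist _ [::] T0.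
apply: (@zariski_dcc _ _ (fun k => zeros [set` sval (t k)])) => k.
  exact: zariski_closed_zeros.
exact: nxP.
Qed.

Lemma zariski_reducibleP V : V !=set0 -> ~ zariski_irreducible V ->
  exists Z1 Z2, [/\ zariski_closed Z1, zariski_closed Z2, V = (V `&` Z1) `|` (V `&` Z2),
    V `&` Z1 `<` V & V `&` Z2 `<` V].
Proof.
move=> V0 /not_andP [//|/existsNP [Z1 /existsNP [Z2]]].
move=> /not_implyP [Z1c /not_implyP [Z2c /not_implyP [VZ /not_orP [nV1 nV2]]]].
exists Z1, Z2; split=> //.
- by rewrite -setIUr; apply/esym/setIidPl.
- split; first exact: subIsetl.
  by apply: contra_not nV1 => VV M /VV [].
- split; first exact: subIsetl.
  by apply: contra_not nV2 => VV M /VV [].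
Qed.

Lemma zariski_irreducible1 (M : 'M[K]_n) : zariski_irreducible [set M].
Proof.
split=> [|Z1 Z2 _ _ ZM]; first by exists M.
by case: (ZM M erefl) => ZM'; [left | right] => N ->.
Qed.

Lemma properset_subset (T : Type) (U V W : set T) : U `<` V -> V `<=` W -> U `<` W.
Proof.
move=> [UV nVU] VW; split; first exact: subset_trans UV VW.
by apply: contra_not nVU; apply: subset_trans.
Qed.

(** In dimension one, an irreducible closed set strictly between a point and
    [W] would make a chain of length two, so the components of [V] are points. *)
Lemma curve_proper_closed_finite A W V :
    (forall m (Z : nat -> set 'M[K]_n), krull_chain A m Z -> (m <= 1)%N) ->
    zariski_closed W -> zariski_irreducible W -> W `<=` A ->
  zariski_closed V -> V `<` W -> finite_set V.
Proof.
move=> dimA Wc Wirr WA; move: V; apply: zariski_induction => V Vc IH VW.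
have [->|/set0P V0] := eqVneq V set0; first exact: finite_set0.
have [Virr|nVirr] := pselect (zariski_irreducible V); last first.
  have [Z1 [Z2 [Z1c Z2c VE VZ1 VZ2]]] := zariski_reducibleP V0 nVirr.
  rewrite VE finite_setU; split; apply: IH => //.
  - exact: zariski_closedI.
  - exact: properset_subset VZ1 (properW VW).
  - exact: zariski_closedI.
  - exact: properset_subset VZ2 (properW VW).
have [M VM] := V0.
have [VM1|nVM1] := pselect (V `<=` [set M]).
  exact: sub_finite_set VM1 (finite_set1 M).
pose Z (i : nat) : set 'M[K]_n := match i with 0 => [set M] | 1 => V | _ => W end.
suff : (2 <= 1)%N by [].
apply: (dimA _ Z); split.
  case=> [|[|[|//]]] _ /=; split=> //; first exact: zariski_closed1.
  - exact: zariski_irreducible1.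
  - by move=> _ ->; apply/WA/(properW VW).
  - exact: subset_trans (properW VW) WA.
case=> [|[|//]] _ /=; last exact: VW.
by split=> // _ ->.
Qed.

End ZariskiClosed.

Section PlaneImage.
Context {K : closedFieldType}.

Definition eval2 (F : {poly {poly K}}) (x y : K) := F.[y%:P].[x].

Lemma eval2M F G x y : eval2 (F * G) x y = eval2 F x y * eval2 G x y.
Proof. by rewrite /eval2 !hornerM. Qed.

Lemma eval2D F G x y : eval2 (F + G) x y = eval2 F x y + eval2 G x y.
Proof. by rewrite /eval2 !hornerD. Qed.

Lemma eval2N F x y : eval2 (- F) x y = - eval2 F x y.
Proof. by rewrite /eval2 !hornerN. Qed.

Lemma eval2C c x y : eval2 c%:P%:P x y = c.
Proof. by rewrite /eval2 !hornerC. Qed.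

Lemma term_polynomial (t : GRing.term K) : GRing.rterm t ->
  exists T, forall x y, GRing.eval [:: x; y] t = eval2 T x y.
Proof.
elim: t => //=.
- move=> [_|[_|i _]].
  + by exists 'X%:P => x y; rewrite /eval2 hornerC hornerX.
  + by exists 'X => x y; rewrite /eval2 hornerX hornerC.
  + by exists 0 => x y; rewrite /eval2 !horner0 /= nth_nil.
- by move=> c _; exists c%:P%:P => x y; rewrite eval2C.
- by move=> k _; exists k%:R%:P%:P => x y; rewrite eval2C.
- move=> t1 IH1 t2 IH2 /andP[/IH1 [T1 E1] /IH2 [T2 E2]]; exists (T1 + T2) => x y.
  by rewrite eval2D E1 E2.
- by move=> t IH /IH [T E]; exists (- T) => x y; rewrite eval2N E.
- move=> t IH k /IH [T E]; exists (T *+ k) => x y.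
  by rewrite E /eval2 !hornerMn.
- move=> t1 IH1 t2 IH2 /andP[/IH1 [T1 E1] /IH2 [T2 E2]]; exists (T1 * T2) => x y.
  by rewrite eval2M E1 E2.
- move=> t IH k /IH [T E]; exists (T ^+ k) => x y.
  by rewrite E /eval2 !horner_exp.
Qed.

(** Off the curve defined by [T1 - T2], an equation [t1 == t2] fails, unless
    [T1 = T2] and it always holds; products of the exceptional curves serve for
    Boolean combinations. *)
Lemma qf_generically_constant (f : GRing.formula K) : GRing.qf_form f -> GRing.rformula f ->
  exists (b : bool) (G : {poly {poly K}}), G != 0 /\
    forall x y, eval2 G x y != 0 -> GRing.qf_eval [:: x; y] f = b.
Proof.
have comb (o : bool -> bool -> bool) (f1 f2 : GRing.formula K) :
    (exists b G, G != 0 /\ forall x y, eval2 G x y != 0 -> GRing.qf_eval [:: x; y] f1 = b) ->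
    (exists b G, G != 0 /\ forall x y, eval2 G x y != 0 -> GRing.qf_eval [:: x; y] f2 = b) ->
    exists (b : bool) (G : {poly {poly K}}), G != 0 /\ forall x y, eval2 G x y != 0 ->
      o (GRing.qf_eval [:: x; y] f1) (GRing.qf_eval [:: x; y] f2) = b.
  move=> [b1 [G1 [G10 E1]]] [b2 [G2 [G20 E2]]].
  exists (o b1 b2), (G1 * G2); split=> [|x y]; first by rewrite mulf_neq0.
  by rewrite eval2M mulf_eq0 negb_or => /andP[/E1-> /E2->].
elim: f => //=.
- by move=> b _ _; exists b, 1; split=> //; apply: oner_neq0.
- move=> t1 t2 _ /andP[/term_polynomial [T1 E1] /term_polynomial [T2 E2]].
  have [T12|neqT] := eqVneq T1 T2.
    by exists true, 1; split=> [|x y _]; rewrite ?oner_neq0 // E1 E2 T12 eqxx.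
  exists false, (T1 - T2); split=> [|x y]; first by rewrite subr_eq0.
  by rewrite eval2D eval2N -E1 -E2 subr_eq0 => /negbTE.
- by move=> f1 IH1 f2 IH2 /andP[q1 q2] /andP[r1 r2]; apply: (comb andb); [exact: IH1|exact: IH2].
- by move=> f1 IH1 f2 IH2 /andP[q1 q2] /andP[r1 r2]; apply: (comb orb); [exact: IH1|exact: IH2].
- by move=> f1 IH1 f2 IH2 /andP[q1 q2] /andP[r1 r2]; apply: (comb implb); [exact: IH1|exact: IH2].
- move=> f IH qf rf; have [b [G [G0 E]]] := IH qf rf; exists (~~ b), G; split=> // x y.
  by move=> /E ->.
Qed.

(** Variables 0 and 1 of the formulas below are the coordinates of the plane;
    the entries of the matrix are the variables from 2 on. *)
Definition mpoly_term {m} (p : mpoly.mpoly m K) : GRing.term K :=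
  foldr (fun u t => GRing.Add (GRing.Mul (GRing.Const (mpoly.mcoeff u p))
    (foldr (fun (i : 'I_m) s => GRing.Mul (GRing.Exp (GRing.Var _ (i + 2)) (mpoly.fun_of_multinom u i)) s)
       (GRing.Const 1) (enum 'I_m))) t)
    (GRing.Const 0) (mpoly.msupp p).

Lemma eval_mpoly_term m (p : mpoly.mpoly m K) (e : seq K) :
  GRing.eval e (mpoly_term p) = mpoly.meval (fun i => e`_(i + 2)) p.
Proof.
rewrite mpoly.mevalE /mpoly_term; elim: (mpoly.msupp p) => [|u s IH] /=.
  by rewrite big_nil.
rewrite big_cons IH; congr (_ * _ + _); rewrite -big_enum /=.
by elim: (enum _) => [|i r IHr] /=; rewrite ?big_nil // big_cons IHr.
Qed.

(** Finitely many equations define [W], so that its image in the plane is given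
    by a first-order formula, from which the entries can be eliminated. *)
Lemma plane_image_constructible n (a b : 'I_(n * n)) (W : set 'M[K]_n) :
    zariski_closed W ->
  exists f : GRing.formula K, [/\ GRing.qf_form f, GRing.rformula f & forall x y,
    GRing.qf_eval [:: x; y] f <-> exists2 M, W M & mxvec M 0 a = x /\ mxvec M 0 b = y].
Proof.
move=> /zariski_closed_finite [s ->].
pose eqs := foldr (fun p f => GRing.And (GRing.Equal (mpoly_term p) (GRing.Const 0)) f)
  (GRing.Bool true) s.
pose body := GRing.And (GRing.Equal (GRing.Var _ (a + 2)) (GRing.Var _ 0))
  (GRing.And (GRing.Equal (GRing.Var _ (b + 2)) (GRing.Var _ 1)) eqs).
pose ex := foldr GRing.Exists body (iota 2 (n * n)).
pose f := GRing.quantifier_elim (@ClosedFieldQE.ex_elim K) (GRing.to_rform ex).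
have rex := GRing.to_rform_rformula ex.
have /andP[qf rf] := GRing.quantifier_elim_wf (@ClosedFieldQE.wf_ex_elim K) rex.
exists f; split=> // x y.
have QE := GRing.quantifier_elim_rformP (@ClosedFieldQE.wf_ex_elim K)
  (ClosedFieldQE.holds_ex_elim (@solve_monicpoly K)) [:: x; y] rex.
apply: (iff_trans (iff_sym (rwP QE))); apply: (iff_trans (GRing.to_rformP _ _)).
apply: (iff_trans (iff_sym (GRing.foldExistsP _ _ _))).
have eqsP e : GRing.holds e eqs <->
    forall p, p \in s -> mpoly.meval (fun i : 'I_(n * n) => e`_(i + 2)) p = 0.
  rewrite /eqs; elim: s {eqs body ex f rex qf rf QE} => [|p s IH] /=.
    by split=> // _ p; rewrite in_nil.
  rewrite IH eval_mpoly_term; split=> [[p0 s0] q|ps0].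
    by rewrite in_cons => /orP[/eqP->|/s0].
  by split=> [|q qs]; apply: ps0; rewrite in_cons ?eqxx ?qs ?orbT.
split=> [[e e_out [/= ea [eb /eqsP es]]]|[M WM [Ma Mb]]].
  have e0 : e`_0 = x by rewrite -(e_out 0%N) // inE /= mem_iota.
  have e1 : e`_1 = y by rewrite -(e_out 1%N) // inE /= mem_iota.
  have vE k : mxvec (vec_mx (\row_(k < n * n) e`_(k + 2)) : 'M[K]_n) 0 k = e`_(k + 2).
    by rewrite vec_mxK mxE.
  exists (vec_mx (\row_k e`_(k + 2))); last by rewrite !vE -e0 -e1.
  move=> p /= ps; apply: etrans (es p ps); apply: mpoly.meval_eq => k; exact: vE.
exists [:: x, y & [seq mxvec M 0 k | k : 'I_(n * n)]].
  move=> [|[|i]] //=; rewrite inE /= mem_iota /= => ni.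
  by rewrite nth_nil nth_default // size_map -cardE card_ord; move: ni; lia.
have vE (k : 'I_(n * n)) : [:: x, y & [seq mxvec M 0 k | k : 'I_(n * n)]]`_(k + 2) = mxvec M 0 k.
  rewrite addn2 /= (nth_map k) ?size_enum_ord // nth_ord_enum //.
rewrite /body /= !vE; split=> //; split=> //; apply/eqsP => p ps.
by apply: etrans (WM p ps); apply: mpoly.meval_eq => k; exact: vE.
Qed.

(** If the image in the plane were dense, it would contain the complement of a
    curve, hence infinitely many points of some vertical line; the part of [W]
    above that line is then an infinite closed proper subset. *)
Lemma curve_plane_image n (a b : 'I_(n * n)) (W : set 'M[K]_n) :
    zariski_closed W -> (forall V, zariski_closed V -> V `<` W -> finite_set V) ->
  exists2 F, F != 0 & forall M, W M -> eval2 F (mxvec M 0 a) (mxvec M 0 b) = 0.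
Proof.
move=> Wc Wfin; apply: contrapT => noF.
have dense F : F != 0 -> exists2 M, W M & eval2 F (mxvec M 0 a) (mxvec M 0 b) != 0.
  move=> F0; apply: contrapT => noM; apply: noF; exists F => // M WM.
  by apply/eqP; apply: contrapT => /negP FM; apply: noM; exists M.
have [f [qf rf fP]] := plane_image_constructible a b Wc.
have [bv [G [G0 GP]]] := qf_generically_constant qf rf.
have {}GP x y : eval2 G x y != 0 -> exists2 M, W M & mxvec M 0 a = x /\ mxvec M 0 b = y.
  move=> Gxy; apply/fP; rewrite (GP _ _ Gxy).
  by have [M WM GM] := dense _ G0; rewrite -(GP _ _ GM); apply/fP; exists M.
have Gc c y : (map_poly (horner_eval c) G).[y] = eval2 G c y.
  by have := horner_map (horner_eval c) G y%:P; rewrite /= !horner_evalE hornerC.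
have [c c_root] : exists c, ~~ root (lead_coef G) c by apply/closed_nonrootP; rewrite lead_coef_eq0.
have Gc0 : map_poly (horner_eval c) G != 0.
  by rewrite map_poly_eq0_id0 // horner_evalE.
pose V := W `&` [set M | mxvec M 0 a = c].
have Vc : zariski_closed V by apply: zariski_closedI => //; apply: zariski_closed_level.
have VW : V `<` W.
  split=> [|WV]; first exact: subIsetl.
  have F0 : ('X - c%:P)%:P != 0 :> {poly {poly K}} by rewrite polyC_eq0 polyXsubC_eq0.
  have [M WM] := dense _ F0.
  by rewrite /eval2 hornerC hornerXsubC (WV M WM).2 subrr eqxx.
have [s Vs] := (finite_seqP _).1 (Wfin V Vc VW).
(* the second factor keeps [y] away from the points [s] already above [x = c] *)
pose g := map_poly (horner_eval c) G * \prod_(M <- s) ('X - (mxvec M 0 b)%:P).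
have [y] : exists y, ~~ root g y.
  by apply/closed_nonrootP; rewrite mulf_neq0 // monic_neq0 // monic_prod_XsubC.
rewrite rootM negb_or /root Gc => /andP[/GP [M WM [Ma Mb]]].
have VM : M \in s by have : V M by []; rewrite Vs.
by rewrite (big_rem _ VM) /= hornerM hornerXsubC Mb subrr mul0r eqxx.
Qed.

(** The product of the relations valid on two pieces is valid on their union,
    which reduces the matter to irreducible sets. *)
Lemma curve_coordinates_dependent n (a b : 'I_(n * n)) (A : set 'M[K]_n) :
    zariski_closed A ->
    (forall m (Z : nat -> set 'M[K]_n), krull_chain A m Z -> (m <= 1)%N) ->
  exists2 F, F != 0 & forall M, A M -> eval2 F (mxvec M 0 a) (mxvec M 0 b) = 0.
Proof.
move=> Ac dimA; suff: forall W : set 'M[K]_n, zariski_closed W -> W `<=` A ->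
    exists2 F, F != 0 & forall M, W M -> eval2 F (mxvec M 0 a) (mxvec M 0 b) = 0.
  by apply.
apply: zariski_induction => W Wc IH WA.
have [W0|/set0P W0] := eqVneq W set0.
  by exists 1; [apply: oner_neq0 | rewrite W0].
have [Wirr|nWirr] := pselect (zariski_irreducible W).
  apply: curve_plane_image => // V Vc; exact: (curve_proper_closed_finite dimA Wc).
have [Z1 [Z2 [Z1c Z2c WE WZ1 WZ2]]] := zariski_reducibleP W0 nWirr.
have [F1 F10 E1] : exists2 F, F != 0 & forall M, (W `&` Z1) M ->
    eval2 F (mxvec M 0 a) (mxvec M 0 b) = 0.
  by apply: IH => //; [exact: zariski_closedI | move=> M [/WA]].
have [F2 F20 E2] : exists2 F, F != 0 & forall M, (W `&` Z2) M ->
    eval2 F (mxvec M 0 a) (mxvec M 0 b) = 0.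
  by apply: IH => //; [exact: zariski_closedI | move=> M [/WA]].
exists (F1 * F2) => [|M]; first by rewrite mulf_neq0.
by rewrite WE eval2M => -[/E1->|/E2->]; rewrite ?mul0r ?mulr0.
Qed.

End PlaneImage.

(** * Real-valued moduli *)

Section Modulus.
Context {R : realType}.
Implicit Types (z w : R[i]) (x : R).

(** The norm of [R[i]] takes its values in the partially ordered field [R[i]];
    the estimates below are carried out in [R]. *)
Definition cabs z : R := complex.Re `|z|.

Lemma normC_cabs z : `|z| = (cabs z)%:C.
Proof. by rewrite /cabs RRe_real ?normr_real. Qed.

Lemma cabs_ge0 z : 0 <= cabs z.
Proof. by rewrite -lecR -normC_cabs normr_ge0. Qed.

Lemma cabs0 : cabs 0 = 0.
Proof. by rewrite /cabs normr0. Qed.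

Lemma cabs1 : cabs 1 = 1.
Proof. by rewrite /cabs normr1. Qed.

Lemma cabsM z w : cabs (z * w) = cabs z * cabs w.
Proof. by apply: complexI; rewrite rmorphM /= -!normC_cabs normrM. Qed.

Lemma cabsN z : cabs (- z) = cabs z.
Proof. by rewrite /cabs normrN. Qed.

Lemma cabsD z w : cabs (z + w) <= cabs z + cabs w.
Proof. by rewrite -lecR rmorphD /= -!normC_cabs ler_normD. Qed.

Lemma cabsB z w : cabs (z - w) = cabs (w - z).
Proof. by rewrite /cabs distrC. Qed.

Lemma cabs_eq0 z : (cabs z == 0) = (z == 0).
Proof. by rewrite -(inj_eq (@complexI R)) -normC_cabs normr_eq0. Qed.

Lemma cabs_gt0 z : (0 < cabs z) = (z != 0).
Proof. by rewrite lt_neqAle cabs_ge0 andbT eq_sym cabs_eq0. Qed.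

Lemma cabsV z : cabs z^-1 = (cabs z)^-1.
Proof. by apply: complexI; rewrite fmorphV /= -!normC_cabs normfV. Qed.

Lemma cabsX z k : cabs (z ^+ k) = cabs z ^+ k.
Proof. by apply: complexI; rewrite rmorphXn /= -!normC_cabs normrX. Qed.

Lemma cabs_real x : cabs x%:C = `|x|.
Proof. by rewrite /cabs normc_def /= expr0n /= addr0 sqrtr_sqr. Qed.

Lemma cabs_sum (I : Type) (r : seq I) (P : pred I) (F : I -> R[i]) :
  cabs (\sum_(i <- r | P i) F i) <= \sum_(i <- r | P i) cabs (F i).
Proof.
elim/big_rec2: _ => [|i y z _ IH]; first by rewrite cabs0.
by rewrite (le_trans (cabsD _ _)) // lerD2l.
Qed.

Lemma cabs_prod (I : Type) (r : seq I) (P : pred I) (F : I -> R[i]) :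
  cabs (\prod_(i <- r | P i) F i) = \prod_(i <- r | P i) cabs (F i).
Proof.
elim/big_rec2: _ => [|i y z _ IH]; first by rewrite cabs1.
by rewrite cabsM IH.
Qed.

Lemma cabs_lower z w : cabs z - cabs w <= cabs (z + w).
Proof. by have := cabsD (z + w) (- w); rewrite addrK cabsN => h; rewrite lerBlDr. Qed.

Lemma cabs_nat k : cabs k%:R = k%:R.
Proof. by rewrite -[k%:R]/(k%:R : R[i]) -(rmorph_nat (real_complex R)) /= cabs_real ger0_norm. Qed.

Definition mxabs {m n} (M : 'M[R[i]]_(m, n)) : R := \sum_i \sum_j cabs (M i j).

Lemma mxabs_ge0 m n (M : 'M[R[i]]_(m, n)) : 0 <= mxabs M.
Proof. by apply: sumr_ge0 => i _; apply: sumr_ge0 => j _; apply: cabs_ge0. Qed.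

Lemma cabs_le_mxabs m n (M : 'M[R[i]]_(m, n)) i j : cabs (M i j) <= mxabs M.
Proof.
rewrite /mxabs (bigD1 i) //= (bigD1 j) //= -addrA lerDl addr_ge0 //.
  by apply: sumr_ge0 => k _; apply: cabs_ge0.
by apply: sumr_ge0 => k _; apply: sumr_ge0 => l _; apply: cabs_ge0.
Qed.

Lemma mxabs_gt0 m n (M : 'M[R[i]]_(m, n)) : M != 0 -> 0 < mxabs M.
Proof.
apply: contraNT; rewrite -leNgt => M0; apply/eqP/matrixP => i j; rewrite mxE.
by apply/eqP; rewrite -cabs_eq0 eq_le cabs_ge0 (le_trans (cabs_le_mxabs M i j)).
Qed.

(** The largest entry carries at least the average. *)
Lemma mxabs_max_entry m n (M : 'M[R[i]]_(m.+1, n.+1)) :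
  exists i j, (forall k l, cabs (M k l) <= cabs (M i j)) /\
    mxabs M <= (m.+1 * n.+1)%:R * cabs (M i j).
Proof.
case: (@arg_maxP _ R _ (ord0, ord0) predT (fun p : 'I_m.+1 * 'I_n.+1 => cabs (M p.1 p.2)) isT).
move=> [i j] _ /= max_ij; exists i, j.
have {}max_ij k l : cabs (M k l) <= cabs (M i j) by have := max_ij (k, l); apply.
split=> //; apply: le_trans (ler_sum _ (fun k _ => ler_sum _ (fun l _ => max_ij k l))) _.
by rewrite !sumr_const !card_ord -mulrnA mulr_natl mulnC.
Qed.

End Modulus.

(** * Rank-one functionals *)

Section RankOne.
Context {R : realType} {n : nat}.
Implicit Types (u v : 'I_n.+1 -> R) (M : 'M[R[i]]_n.+1).

(** The linear form [M |-> u M v], with [u] a row and [v] a column. *)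
Definition bil u v M : R[i] := \sum_i \sum_j (u i * v j)%:C * M i j.

Lemma bilB u v M N : bil u v (M - N) = bil u v M - bil u v N.
Proof.
rewrite /bil -sumrB; apply: eq_bigr => i _; rewrite -sumrB; apply: eq_bigr => j _.
by rewrite !mxE mulrBr.
Qed.

Lemma bilZ u v c M : bil u v (c *: M) = c * bil u v M.
Proof.
rewrite /bil mulr_sumr; apply: eq_bigr => i _; rewrite mulr_sumr; apply: eq_bigr => j _.
by rewrite !mxE mulrCA.
Qed.

Lemma bil_le u v M (a b : R) : (forall i, `|u i| <= a) -> (forall j, `|v j| <= b) ->
  cabs (bil u v M) <= a * b * mxabs M.
Proof.
move=> ua vb; rewrite mulr_sumr (le_trans (cabs_sum _ _ _)) // ler_sum // => i _.
rewrite mulr_sumr (le_trans (cabs_sum _ _ _)) // ler_sum // => j _.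
rewrite cabsM ler_wpM2r ?cabs_ge0 // cabs_real normrM.
by apply: ler_pM => //; apply: normr_ge0.
Qed.

Lemma bil_pert u v du dv M :
  bil (fun i => u i + du i) (fun j => v j + dv j) M =
  bil u v M + bil u dv M + bil du v M + bil du dv M.
Proof.
rewrite /bil -!big_split; apply: eq_bigr => i _; rewrite -!big_split.
by apply: eq_bigr => j _ /=; rewrite !(rmorphD, rmorphM) /=; ring.
Qed.

Definition spike (e : R) (i : 'I_n.+1) : 'I_n.+1 -> R := fun k => e * (k == i)%:R.

Lemma bil_spike e i j M : bil (spike e i) (spike e j) M = (e ^+ 2)%:C * M i j.
Proof.
rewrite /bil (bigD1 i) //= (bigD1 j) //= !big1 => [|k ki|k kj].
- by rewrite /spike !eqxx !mulr1 !addr0.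
- by rewrite big1 // => l _; rewrite /spike (negbTE ki) mulr0 mul0r mul0r.
- by rewrite /spike (negbTE kj) !mulr0 mul0r.
Qed.

(** Second differences recover the entry [M i j], so one of the four corners of
    the square spanned by two perturbations gives a value of at least a quarter
    of it. *)
Lemma exists_perturbation u v e M : 0 <= e ->
  exists u' v', [/\ forall i, u i <= u' i <= u i + e, forall j, v j <= v' j <= v j + e &
    e ^+ 2 / (4 * (n.+1 * n.+1)%:R) * mxabs M <= cabs (bil u' v' M)].
Proof.
move=> e0; have [i [j [_ maxM]]] := mxabs_max_entry M.
have spike_ge0 k l : 0 <= spike e k l by rewrite mulr_ge0.
have spike_le k l : spike e k l <= e by rewrite /spike ler_piMr // lern1 leq_b1.
set q := _ / _.
have N0 : 0 < (n.+1 * n.+1)%:R :> R by rewrite ltr0n.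
have qM : q * mxabs M * 4 <= e ^+ 2 * cabs (M i j).
  have -> : e ^+ 2 * cabs (M i j) = q * ((n.+1 * n.+1)%:R * cabs (M i j)) * 4.
    by rewrite /q; move: (n.+1 * n.+1)%:R N0 => N N0; field; apply: lt0r_neq0.
  by rewrite ler_wpM2r // ler_wpM2l // /q divr_ge0 ?sqr_ge0 // mulr_ge0 // ltW.
pose B a b := bil (fun k => u k + a * spike e i k) (fun k => v k + b * spike e j k) M.
(* the second difference of the values at the corners (a, b) of the square *)
have four : (e ^+ 2)%:C * M i j = B 1 1 - B 1 0 - B 0 1 + B 0 0.
  rewrite -bil_spike /B.
  have z (f g : 'I_n.+1 -> R) : (fun k => f k + 0 * g k) = f.
    by apply/funext => k; rewrite mul0r addr0.
  have o (f g : 'I_n.+1 -> R) : (fun k => f k + 1 * g k) = (fun k => f k + g k).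
    by apply/funext => k; rewrite mul1r.
  have p1 := bil_pert u v (spike e i) (fun=> 0) M; have p2 := bil_pert u v (fun=> 0) (spike e j) M.
  have zz (f : 'I_n.+1 -> R) : (fun k => f k + 0) = f by apply/funext => k; rewrite addr0.
  have b0l (f : 'I_n.+1 -> R) : bil (fun=> 0) f M = 0.
    by rewrite /bil big1 // => k _; rewrite big1 // => l _; rewrite mul0r mul0r.
  have b0r (f : 'I_n.+1 -> R) : bil f (fun=> 0) M = 0.
    by rewrite /bil big1 // => k _; rewrite big1 // => l _; rewrite mulr0 mul0r.
  rewrite zz !b0r in p1; rewrite zz !b0l in p2.
  by rewrite !z !o p1 p2 bil_pert; ring.
have [a [b [a01 b01 big]]] : exists a b : R, [/\ 0 <= a <= 1, 0 <= b <= 1 & q * mxabs M <= cabs (B a b)].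
  apply: contrapT => small.
  have lt a b : 0 <= a <= 1 -> 0 <= b <= 1 -> cabs (B a b) < q * mxabs M.
    by move=> a01 b01; rewrite ltNge; apply/negP => h; apply: small; exists a, b.
  have : e ^+ 2 * cabs (M i j) <= cabs (B 1 1) + cabs (B 1 0) + cabs (B 0 1) + cabs (B 0 0).
    rewrite -[e ^+ 2]ger0_norm ?sqr_ge0 // -cabs_real -cabsM four.
    apply: le_trans (cabsD _ _) _; rewrite lerD2r.
    apply: le_trans (cabsD _ _) _; rewrite cabsN lerD2r.
    by apply: le_trans (cabsD _ _) _; rewrite cabsN lerD2r.
  have o1 : 0 <= (1 : R) <= 1 by rewrite ler01 lexx.
  have z1 : 0 <= (0 : R) <= 1 by rewrite ler01 lexx.
  have := lt 1 1 o1 o1; have := lt 1 0 o1 z1; have := lt 0 1 z1 o1; have := lt 0 0 z1 z1.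
  by move: qM; lra.
have bd k c : 0 <= c <= 1 -> forall l, 0 <= c * spike e k l <= e.
  move=> /andP[c0 c1] l; rewrite mulr_ge0 //= (le_trans _ (spike_le k l)) //.
  by rewrite ler_piMl.
exists (fun k => u k + a * spike e i k), (fun k => v k + b * spike e j k); split=> // k.
  by rewrite lerDl lerD2l; apply: bd.
by rewrite lerDl lerD2l; apply: bd.
Qed.

End RankOne.

Section GenericFunctional.
Context {R : realType}.

Lemma slow_growth_limit (a e : nat -> R) :
    (forall k, a k <= a k.+1 <= a k + e k) -> (forall k, 0 <= e k) ->
    (forall k, e k.+1 <= e k / 2) ->
  exists L, forall k, a k <= L <= a k + 2 * e k.
Proof.
move=> a_step e0 e_step.
have inc : {homo a : k l / (k <= l)%N >-> k <= l}.
  by apply: homo_leq => // [x y z|k]; [apply: le_trans | have /andP[] := a_step k].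
have dec : {homo (fun k => a k + 2 * e k) : k l / (k <= l)%N >-> l <= k}.
  apply: homo_leq => // [y x z xy yz|k]; first exact: le_trans yz xy.
  by have := a_step k; have := e_step k; lra.
have ub k : ubound (range a) (a k + 2 * e k).
  move=> _ [l _ <-]; have [kl|/ltnW lk] := leqP k l.
    by apply: le_trans (dec _ _ kl); rewrite lerDl mulr_ge0.
  by apply: le_trans (inc _ _ lk) _; rewrite lerDl mulr_ge0.
have a0 : range a !=set0 by exists (a 0%N), 0%N.
exists (sup (range a)) => k; apply/andP; split.
  by apply: ub_le_sup; [exists (a 0%N + 2 * e 0%N); apply: ub | exists k].
exact: ge_sup.
Qed.

(** Each step perturbs the functional so as to be large on the next matrix, by
    amounts so small that the values already secured survive all later
    perturbations. The amounts, and with them [c], are fixed once and for all. *)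
Lemma generic_functional n : exists c : nat -> R, (forall k, 0 < c k) /\
  forall M : nat -> 'M[R[i]]_n.+1, exists u v : 'I_n.+1 -> R,
    [/\ u ord0 = 1, v ord0 = 1 & forall k, c k * mxabs (M k) <= cabs (bil u v (M k))].
Proof.
pose N : R := (n.+1 * n.+1)%:R.
have N1 : 1 <= N by rewrite ler1n muln_gt0.
pose e := fix e k : R := if k is k'.+1 then e k' ^+ 2 / (64 * N) else 1 / 4.
(* Step [k] secures [16 * e k.+1 * mxabs (M k)] by its choice of corner, since
   [e k ^ 2 = 64 * N * e k.+1]; all later steps together cost at most half. *)
have eS k : e k.+1 * (64 * N) = e k ^+ 2 by rewrite /= divfK //; apply: lt0r_neq0; lra.
have e_bd k : 0 < e k <= 1 / 4.
  elim: k => [|k IH]; first by rewrite /=; lra.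
  apply/andP; split; first by rewrite /= divr_gt0 ?exprn_gt0 ?mulr_gt0 //; lra.
  by have := eS k; move: IH; move: (e k) (e k.+1) => x y; nra.
have e0 k : 0 <= e k by have := e_bd k; lra.
have e_half k : e k.+1 <= e k / 2.
  by have := eS k; have := e_bd k; have := e_bd k.+1; move: (e k) (e k.+1) => x y; nra.
exists (fun k => e k ^+ 2 / (32 * N)); split=> [k|M].
  by rewrite divr_gt0 ?exprn_gt0 ?mulr_gt0 //; have := e_bd k; lra.
pose ok k (s t : ('I_n.+1 -> R) * ('I_n.+1 -> R)) :=
  [/\ forall i, s.1 i <= t.1 i <= s.1 i + e k, forall j, s.2 j <= t.2 j <= s.2 j + e k &
      e k ^+ 2 / (4 * N) * mxabs (M k) <= cabs (bil t.1 t.2 (M k))].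
have step ks : exists t, ok ks.1 ks.2 t.
  by have [u' [v' H]] := exists_perturbation ks.2.1 ks.2.2 (M ks.1) (e0 ks.1); exists (u', v').
have [g gP] := choice step.
pose s0 : 'I_n.+1 -> R := fun i => (i == ord0)%:R.
pose s := fix s k := if k is k'.+1 then g (k', s k') else (s0, s0).
have sP k : ok k (s k) (s k.+1) := gP (k, s k).
have sP1 i k : (s k).1 i <= (s k.+1).1 i <= (s k).1 i + e k by have [] := sP k.
have sP2 i k : (s k).2 i <= (s k.+1).2 i <= (s k).2 i + e k by have [] := sP k.
have [u uP] := choice (fun i => slow_growth_limit (sP1 i) e0 e_half).
have [v vP] := choice (fun i => slow_growth_limit (sP2 i) e0 e_half).
have start i : 0 <= s0 i <= 1 by rewrite /s0 ler0n lern1 leq_b1.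
have u_bd i : 0 <= u i <= 2.
  by have := uP i 0%N; have := start i; rewrite /=; lra.
have v_bd i : 0 <= v i <= 2.
  by have := vP i 0%N; have := start i; rewrite /=; lra.
have u0 : 1 <= u ord0 by have := uP ord0 0%N; rewrite /= /s0 eqxx /=; lra.
have v0 : 1 <= v ord0 by have := vP ord0 0%N; rewrite /= /s0 eqxx /=; lra.
have bil_uv k : e k ^+ 2 / (8 * N) * mxabs (M k) <= cabs (bil u v (M k)).
  have [_ _ big] := sP k; move: big.
  set a := (s k.+1).1; set b := (s k.+1).2 => big.
  have da i : `|u i - a i| <= 2 * e k.+1.
    by have h : a i <= u i <= a i + 2 * e k.+1 := uP i k.+1; rewrite ger0_norm; lra.
  have db i : `|v i - b i| <= 2 * e k.+1.
    by have h : b i <= v i <= b i + 2 * e k.+1 := vP i k.+1; rewrite ger0_norm; lra.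
  have a_bd i : `|a i| <= 2.
    have h : a i <= u i <= a i + 2 * e k.+1 := uP i k.+1.
    by rewrite ler_norml; have := u_bd i; have := e_bd k.+1; lra.
  have uE : u = (fun i => a i + (u i - a i)) by apply/funext => i; rewrite addrC subrK.
  have vE : v = (fun i => b i + (v i - b i)) by apply/funext => i; rewrite addrC subrK.
  have u2 i : `|u i| <= 2 by have h := u_bd i; rewrite ger0_norm; lra.
  pose du i := u i - a i; pose dv i := v i - b i.
  have bilE : bil u v (M k) = bil a b (M k) + (bil a dv (M k) + bil du v (M k)).
    rewrite {1}uE {1}vE bil_pert -!addrA; congr (_ + (_ + _)).
    rewrite {2}vE /bil -big_split; apply: eq_bigr => i _; rewrite -big_split.
    by apply: eq_bigr => j _; rewrite /= /du /dv !(rmorphD, rmorphM) /=; ring.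
  have v2 i : `|v i| <= 2 by have h := v_bd i; rewrite ger0_norm; lra.
  have small1 := @bil_le R n a dv (M k) _ _ a_bd db.
  have small2 := @bil_le R n du v (M k) _ _ da v2.
  have small := cabsD (bil a dv (M k)) (bil du v (M k)).
  have := cabs_lower (bil a b (M k)) (bil a dv (M k) + bil du v (M k)).
  rewrite -bilE.
  have eE : e k ^+ 2 = e k.+1 * (64 * N) := esym (eS k).
  rewrite eE in big *.
  have -> : e k.+1 * (64 * N) / (8 * N) * mxabs (M k) = 8 * e k.+1 * mxabs (M k).
    by move: (N) N1 => N' N'1; field; apply: lt0r_neq0; lra.
  move: big; have -> : e k.+1 * (64 * N) / (4 * N) * mxabs (M k) = 16 * e k.+1 * mxabs (M k).
    by move: (N) N1 => N' N'1; field; apply: lt0r_neq0; lra.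
  by lra.
(* normalizing the first coordinates, which lie between 1 and 2 *)
have uv0 : (u ord0)^-1 * (v ord0)^-1 >= 1 / 4.
  have -> : 1 / 4 = 2^-1 * 2^-1 :> R by field.
  by apply: ler_pM; rewrite ?invr_ge0 ?lef_pV2 ?posrE //;
     have := u_bd ord0; have := v_bd ord0; lra.
exists (fun i => u i / u ord0), (fun j => v j / v ord0); split=> [||k].
- by rewrite divff //; apply: lt0r_neq0; lra.
- by rewrite divff //; apply: lt0r_neq0; lra.
have -> : bil (fun i => u i / u ord0) (fun j => v j / v ord0) (M k) =
    ((u ord0)^-1 * (v ord0)^-1)%:C * bil u v (M k).
  rewrite /bil mulr_sumr; apply: eq_bigr => i _; rewrite mulr_sumr.
  by apply: eq_bigr => j _; rewrite !rmorphM /=; ring.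
rewrite cabsM cabs_real ger0_norm; last by lra.
apply: le_trans (ler_pM _ _ uv0 (bil_uv k)); last 2 first.
- by lra.
- by rewrite mulr_ge0 ?mxabs_ge0 // divr_ge0 ?sqr_ge0 // mulr_ge0; lra.
rewrite mulrA le_eqVlt; apply/orP; left; apply/eqP; congr (_ * _).
by move: (N) N1 => N' N'1; field; apply: lt0r_neq0; lra.
Qed.

End GenericFunctional.

(** * Directions at infinity *)

Section Directions.
Context {R : realType}.

(** A value is the product of the leading coefficient and of the differences to
    the roots [s], which cannot all exceed [eps] if it is small. *)
Lemma poly_small_near_root (q : {poly R[i]}) : q != 0 ->
  exists s : seq R[i], forall eps : R, 0 < eps -> exists2 del, 0 < del &
    forall t, cabs q.[t] < del -> exists2 r, r \in s & cabs (t - r) < eps.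
Proof.
move=> q0; have [s qE] := closed_field_poly_normal q; exists s => eps eps0.
have lq0 : 0 < cabs (lead_coef q) by rewrite cabs_gt0 lead_coef_eq0.
exists (cabs (lead_coef q) * eps ^+ size s) => [|t]; first by rewrite mulr_gt0 ?exprn_gt0.
move=> small; apply: contrapT => far; move: small.
have -> : q.[t] = lead_coef q * \prod_(r <- s) (t - r).
  by rewrite [in LHS]qE hornerZ horner_prod; congr (_ * _); apply: eq_bigr => r _; rewrite hornerXsubC.
apply/negP; rewrite -leNgt cabsM ler_wpM2l ?cabs_ge0 // cabs_prod.
have {}far r : r \in s -> eps <= cabs (t - r).
  by move=> rs; rewrite leNgt; apply/negP => lt_eps; apply: far; exists r.
have -> : eps ^+ size s = \prod_(r <- s) eps.
  by elim: (s) => [|r s' IH]; rewrite ?big_nil // big_cons -IH exprS.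
rewrite big_seq [X in _ <= X]big_seq; apply: ler_prod => r rs.
by rewrite ltW //= far.
Qed.

(** Dividing the equation by the power of [x] of total degree leaves, up to
    O(1/|x|), the top homogeneous part evaluated at the slope. *)
Lemma plane_curve_slopes (F : {poly {poly R[i]}}) : F != 0 ->
  exists s : seq R[i], forall eps : R, 0 < eps -> exists B : R, forall x y,
    eval2 F x y = 0 -> cabs y <= cabs x -> B < cabs x ->
    exists2 r, r \in s & cabs (y / x - r) < eps.
Proof.
move=> F0.
pose N := maxn (size F) (\max_(j < size F) size (F`_j)%R).
pose c (p : 'I_N * 'I_N) := (F`_p.2 : {poly R[i]})`_p.1.
have FE x y : eval2 F x y = \sum_p c p * x ^+ p.1 * y ^+ p.2.
  rewrite /eval2 (@horner_coef_wide _ N F) ?leq_maxl // horner_sum.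
  rewrite -(pair_bigA _ (fun i j => c (i, j) * x ^+ i * y ^+ j)) exchange_big /=.
  apply: eq_bigr => j _; rewrite -polyC_exp hornerM hornerC (@horner_coef_wide _ N).
    by rewrite mulr_suml.
  have [lt_j|ge_j] := ltnP j (size F); last by rewrite nth_default ?size_poly0.
  exact: leq_trans (leq_bigmax (F := fun j : 'I_(size F) => size (F`_j)%R) (Ordinal lt_j)) (leq_maxr _ _).
have [p0 p0P] : exists p, c p != 0.
  have lt1 : ((size F).-1 < size F)%N by rewrite prednK ?lt0n ?size_poly_eq0.
  have lt2 : ((size (lead_coef F)).-1 < size (lead_coef F))%N.
    by rewrite prednK ?lt0n ?size_poly_eq0 ?lead_coef_eq0.
  have lt2N : ((size (lead_coef F)).-1 < N)%N.
    apply: (leq_trans lt2); apply: leq_trans (leq_maxr _ _).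
    exact: (leq_bigmax (F := fun j : 'I_(size F) => size (F`_j)%R) (Ordinal lt1)).
  exists (Ordinal lt2N, Ordinal (leq_trans lt1 (leq_maxl _ _))).
  by rewrite /c /= -/(lead_coef F) -/(lead_coef (lead_coef F)) !lead_coef_eq0.
have [pm pm0 pm_max] := @arg_maxnP _ p0 (fun p => c p != 0) (fun p : 'I_N * 'I_N => (p.1 + p.2)%N) p0P.
set d := (pm.1 + pm.2)%N in pm_max.
pose q : {poly R[i]} := \sum_(p : 'I_N * 'I_N | (p.1 + p.2 == d)%N) c p *: 'X^(p.2).
have q0 : q != 0.
  apply/eqP => /(congr1 (fun f : {poly R[i]} => f`_pm.2)); rewrite coef0 coef_sum.
  rewrite (bigD1 pm) //= big1 ?addr0 => [|p /andP[/eqP pd neq_p]].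
    by rewrite coefZ coefXn eqxx mulr1 => /eqP; apply/negP.
  rewrite coefZ coefXn; case: eqP => [p2|_]; last by rewrite mulr0.
  case/eqP: neq_p; apply/eqP; rewrite -pair_eqE /pair_eq /= -!val_eqE /= -p2 eqxx andbT.
  by move: pd; rewrite /d p2 => /addIn ->.
have [s sP] := poly_small_near_root q0; exists s => eps /sP [del del0 near_root].
pose C := \sum_p cabs (c p); exists (Num.max 1 (C / del)) => x y Fxy le_yx.
rewrite gt_max => /andP[x1 xC]; apply: near_root; set t := y / x.
have x0 : x != 0 by rewrite -cabs_gt0; lra.
have t1 : cabs t <= 1 by rewrite cabsM cabsV ler_pdivrMr ?mul1r //; lra.
have yE : y = t * x by rewrite /t divfK.
clearbody t.
have top : x ^+ d * q.[t] = - \sum_(p : 'I_N * 'I_N | (p.1 + p.2 != d)%N) c p * t ^+ p.2 * x ^+ (p.1 + p.2).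
  apply/eqP; rewrite -addr_eq0; apply/eqP.
  have := Fxy; rewrite FE (bigID (fun p : 'I_N * 'I_N => (p.1 + p.2 == d)%N)) /= => E.
  apply: etrans E; congr (_ + _); last first.
    by apply: eq_bigr => p _; rewrite yE exprMn exprD mulrACA.
  rewrite horner_sum mulr_sumr; apply: eq_bigr => p /eqP pd.
  by rewrite hornerZ hornerXn yE exprMn -pd exprD mulrC mulrACA.
have bound : cabs x * (cabs x ^+ d * cabs q.[t]) <= C * cabs x ^+ d.
  rewrite -cabsX -cabsM top cabsN.
  apply: (@le_trans _ _ (cabs x * \sum_(p : 'I_N * 'I_N | (p.1 + p.2 != d)%N) cabs (c p * t ^+ p.2 * x ^+ (p.1 + p.2)))).
    by rewrite ler_wpM2l ?cabs_ge0 // cabs_sum.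
  rewrite mulr_sumr mulr_suml [X in _ <= X](bigID (fun p : 'I_N * 'I_N => (p.1 + p.2 != d)%N)) /=.
  rewrite -[X in X <= _]addr0 lerD //; last first.
    by apply: sumr_ge0 => p _; rewrite mulr_ge0 ?cabs_ge0.
  apply: ler_sum => p pd; have [->|cp0] := eqVneq (c p) 0.
    by rewrite !mul0r cabs0 mulr0 mul0r.
  have lt_pd : (p.1 + p.2 < d)%N by rewrite ltn_neqAle pd; apply: pm_max.
  rewrite !cabsM !cabsX mulrCA -mulrA ler_wpM2l ?cabs_ge0 //.
  rewrite -[X in _ <= X]mul1r ler_pM ?mulr_ge0 ?exprn_ge0 ?cabs_ge0 //.
    by rewrite exprn_ile1 ?cabs_ge0.
  by rewrite -exprS ler_weXn2l // ltW.
have xd0 : 0 < cabs x ^+ d by rewrite exprn_gt0 // cabs_gt0.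
have : cabs x * cabs q.[t] <= C by rewrite -(ler_pM2r xd0) -mulrA [cabs q.[t] * _]mulrC.
have : C < del * cabs x by rewrite mulrC -ltr_pdivrMr.
move=> C1 C2; rewrite -(ltr_pM2r (lt_trans ltr01 x1)).
by rewrite mulrC; apply: le_lt_trans C2 C1.
Qed.

End Directions.

Section ProperFunctional.
Context {R : realType}.

Lemma generic_functional_countable n (T : countType) : exists c : T -> R, (forall k, 0 < c k) /\
  forall M : T -> 'M[R[i]]_n.+1, exists u v : 'I_n.+1 -> R,
    [/\ u ord0 = 1, v ord0 = 1 & forall k, c k * mxabs (M k) <= cabs (bil u v (M k))].
Proof.
have [c [c0 cP]] := @generic_functional R n.
exists (fun k => c (pickle k)); split=> // M.
have [u [v [u0 v0 uvP]]] := cP (fun k => if unpickle k is Some t then M t else 0).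
by exists u, v; split=> // k; have := uvP (pickle k); rewrite pickleK.
Qed.

(** A large point divided by its largest entry [w] has all its entries close to
    slopes at infinity of plane curves, which form finite sets; the entry that
    became 1 keeps the limit [N] from vanishing. *)
Lemma curve_directions n (A : set 'M[R[i]]_n.+1) :
    zariski_closed A ->
    (forall m (Z : nat -> set 'M[R[i]]_n.+1), krull_chain A m Z -> (m <= 1)%N) ->
  exists S : seq 'M[R[i]]_n.+1, (forall N, N \in S -> N != 0) /\
    forall eps : R, 0 < eps < 1 -> exists B : R, forall M, A M -> B < mxabs M ->
      exists2 N, N \in S & exists w : R[i], mxabs M <= (n.+1 * n.+1)%:R * cabs w /\
        mxabs (w^-1 *: M - N) <= (n.+1 * n.+1)%:R * eps.
Proof.
move=> Ac dimA; pose I := ('I_n.+1 * 'I_n.+1)%type.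
have /choice [s sP] (p : I * I) : exists s : seq R[i], forall eps : R, 0 < eps ->
    exists B : R, forall M, A M -> cabs (M p.2.1 p.2.2) <= cabs (M p.1.1 p.1.2) ->
      B < cabs (M p.1.1 p.1.2) ->
      exists2 r, r \in s & cabs (M p.2.1 p.2.2 / M p.1.1 p.1.2 - r) < eps.
  have [F F0 FA] := curve_coordinates_dependent (mxvec_index p.1.1 p.1.2)
    (mxvec_index p.2.1 p.2.2) Ac dimA.
  have [s sP] := plane_curve_slopes F0; exists s => eps /sP [B BP]; exists B => M AM.
  by have := FA M AM; rewrite !mxvecE; apply: BP.
pose L := flatten [seq s p | p <- enum {: I * I}].
pose mx (f : {ffun I -> 'I_(size L)}) : 'M[R[i]]_n.+1 := \matrix_(i, j) L`_(f (i, j)).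
exists [seq N <- [seq mx f | f <- enum {: {ffun I -> 'I_(size L)}}] | N != 0].
split=> [N|eps /andP[eps0 eps1]]; first by rewrite mem_filter => /andP[].
have /choice [B BP] p := sP p eps eps0.
exists ((n.+1 * n.+1)%:R * \sum_p `|B p|) => M AM ltM.
have [i [j [max_ij avg_ij]]] := mxabs_max_entry M.
have lt_ij : \sum_p `|B p| < cabs (M i j).
  have N0 : 0 < (n.+1 * n.+1)%:R :> R by rewrite ltr0n.
  by rewrite -(ltr_pM2l N0); apply: lt_le_trans ltM avg_ij.
have w0 : M i j != 0.
  by rewrite -cabs_gt0; apply: le_lt_trans lt_ij; apply: sumr_ge0.
have /choice [r rP] (b : I) : exists r, r \in s ((i, j), b) /\ cabs (M b.1 b.2 / M i j - r) < eps.
  have [|r rs re] := BP ((i, j), b) M AM (max_ij _ _); last by exists r.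
  apply: le_lt_trans lt_ij; rewrite (bigD1 ((i, j), b)) //=.
  by rewrite (le_trans (ler_norm _)) // lerDl sumr_ge0.
have rL b : (index (r b) L < size L)%N.
  rewrite index_mem; apply/flattenP; exists (s ((i, j), b)); last by case: (rP b).
  by apply: map_f; rewrite mem_enum.
pose N := mx [ffun b => Ordinal (rL b)].
have NE k l : N k l = r (k, l) by rewrite mxE ffunE /= nth_index // -index_mem.
have NS : N \in [seq mx f | f <- enum {: {ffun I -> 'I_(size L)}}].
  by rewrite map_f ?mem_enum.
clearbody N; exists N; last first.
  exists (M i j); split=> //; rewrite /mxabs.
  apply: (@le_trans _ _ (\sum_(k < n.+1) \sum_(l < n.+1) eps)).
    apply: ler_sum => k _; apply: ler_sum => l _; rewrite !mxE NE.
    by have [_] := rP (k, l); rewrite /= mulrC => /ltW.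
  by rewrite !sumr_const !card_ord -mulrnA mulr_natl.
rewrite mem_filter NS andbT.
apply/eqP => /matrixP /(_ i j); rewrite NE mxE => r0.
have [_] := rP (i, j); rewrite /= r0 subr0 divff // cabs1; lra.
Qed.

(** A functional that is nonzero in all the limit directions is proper on the
    curve. *)
Lemma curve_proper_functional n (A : set 'M[R[i]]_n.+1) (T : countType) (g : T -> 'M[R[i]]_n.+1) :
    zariski_closed A ->
    (forall m (Z : nat -> set 'M[R[i]]_n.+1), krull_chain A m Z -> (m <= 1)%N) ->
  exists u v : 'I_n.+1 -> R,
    [/\ u ord0 = 1, v ord0 = 1, forall k, g k != 0 -> bil u v (g k) != 0 &
      exists c B : R, 0 < c /\ forall M, A M -> B < mxabs M -> c * mxabs M <= cabs (bil u v M)].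
Proof.
move=> Ac dimA; have [S [S0 SP]] := curve_directions Ac dimA.
have [c [c0 cP]] := generic_functional_countable n (T + nat)%type.
have [u [v [u0 v0 uvP]]] := cP (fun k => match k with inl t => g t | inr i => S`_i end).
have bil0 (N : 'M[R[i]]_n.+1) k : 0 < c k ->
    c k * mxabs N <= cabs (bil u v N) -> N != 0 -> bil u v N != 0.
  move=> ck cN N0; rewrite -cabs_gt0; apply: lt_le_trans cN.
  by rewrite mulr_gt0 // mxabs_gt0.
exists u, v; split=> // [k gk|]; first exact: bil0 (c0 _) (uvP (inl k)) gk.
have [del del0 delP] : exists2 del : R, 0 < del & forall N, N \in S -> del <= cabs (bil u v N).
  have Sb N : N \in S -> 0 < cabs (bil u v N).
    move=> NS; rewrite cabs_gt0; have := uvP (inr (index N S)); rewrite /= nth_index //.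
    by move/bil0; apply => //; exact: S0.
  elim: S Sb {SP S0 uvP} => [|N S IH] Sb; first by exists 1.
  have [N' N'S|del del0 delP] := IH; first by apply: Sb; rewrite in_cons N'S orbT.
  exists (Num.min del (cabs (bil u v N))) => [|N'].
    by rewrite lt_min del0 Sb // mem_head.
  by rewrite ge_min in_cons => /orP[/eqP->|/delP->]; rewrite ?lexx ?orbT.
pose a := \sum_i `|u i|; pose b := \sum_j `|v j|.
have a_ge i : `|u i| <= a by rewrite /a (bigD1 i) //= lerDl sumr_ge0.
have b_ge j : `|v j| <= b by rewrite /b (bigD1 j) //= lerDl sumr_ge0.
pose m : R := (n.+1 * n.+1)%:R.
have m0 : 0 < m by rewrite ltr0n.
have a0 : 0 <= a by rewrite sumr_ge0.
have b0 : 0 <= b by rewrite sumr_ge0.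
pose q := a * b * m.
have q0 : 0 <= q by rewrite !mulr_ge0 // ltW.
pose eps := Num.min (1 / 2) (del / (2 * (q + 1))).
have e0 : 0 < eps.
  by rewrite /eps lt_min; apply/andP; split; [lra | rewrite divr_gt0 //; lra].
have e_half : eps <= 1 / 2 by rewrite ge_min lexx.
have eps_q : q * eps <= del / 2.
  have : eps <= del / (2 * (q + 1)) by rewrite ge_min lexx orbT.
  rewrite ler_pdivlMr; last by lra.
  by move: eps e0 {e_half} => x; nra.
have eps01 : 0 < eps < 1 by rewrite e0 /=; lra.
have [B BP] := SP eps eps01.
exists (del / (2 * m)), B; split=> [|M AM /(BP M AM) [N NS [w [Mw Mclose]]]].
  by rewrite divr_gt0 // mulr_gt0.
have [w0|w0] := eqVneq w 0.
  rewrite w0 cabs0 mulr0 in Mw; have -> : mxabs M = 0 by apply/le_anti; rewrite Mw mxabs_ge0.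
  by rewrite mulr0 cabs_ge0.
have ME : M = w *: (N + (w^-1 *: M - N)) by rewrite addrC subrK scalerA divff // scale1r.
have -> : bil u v M = w * (bil u v (w^-1 *: M - N) + bil u v N).
  by rewrite bilB subrK -bilZ scalerA divff // scale1r.
have small := @bil_le R n u v (w^-1 *: M - N) a b a_ge b_ge.
have := cabs_lower (bil u v N) (bil u v (w^-1 *: M - N)).
rewrite cabsM [bil u v N + _]addrC => low.
have big : del / 2 <= cabs (bil u v (w^-1 *: M - N) + bil u v N).
  apply: le_trans low; have := delP N NS.
  have : a * b * mxabs (w^-1 *: M - N) <= q * eps.
    by rewrite /q -[X in _ <= X]mulrA ler_wpM2l // mulr_ge0.
  by lra.
apply: (@le_trans _ _ (cabs w * (del / 2))); last by rewrite ler_wpM2l ?cabs_ge0.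
have -> : cabs w * (del / 2) = del / (2 * m) * (m * cabs w).
  by field; apply: lt0r_neq0.
by rewrite ler_wpM2l // ltW // divr_gt0 // mulr_gt0.
Qed.

End ProperFunctional.

(** * Entire functions with prescribed values *)

Section Series.
Context {R : realType}.
Implicit Types (a b : nat -> R[i]) (l m : R[i]).

Definition has_sum a l := forall eps : R, 0 < eps -> exists N, forall n, (N <= n)%N ->
  cabs (\sum_(i < n) a i - l) <= eps.

Lemma has_sumD a b l m : has_sum a l -> has_sum b m -> has_sum (fun i => a i + b i) (l + m).
Proof.
move=> al bm eps eps0; have e2 : 0 < eps / 2 by lra.
have [N1 H1] := al _ e2; have [N2 H2] := bm _ e2.
exists (maxn N1 N2) => n; rewrite geq_max => /andP[/H1 h1 /H2 h2].
rewrite big_split /= opprD addrACA; apply: le_trans (cabsD _ _) _; lra.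
Qed.

Lemma has_sumZ a c l : has_sum a l -> has_sum (fun i => c * a i) (c * l).
Proof.
move=> al eps eps0; have c1 : 0 < cabs c + 1 by have := cabs_ge0 c; lra.
have e1 : 0 < eps / (cabs c + 1) by rewrite divr_gt0.
have [N H] := al _ e1; exists N => n /H; rewrite ler_pdivlMr // => h.
rewrite -mulr_sumr -mulrBr cabsM; apply: le_trans h.
by rewrite mulrC ler_wpM2l ?cabs_ge0 // lerDl.
Qed.

Lemma has_sum_le a l (B : R) :
  has_sum a l -> (forall n, \sum_(i < n) cabs (a i) <= B) -> cabs l <= B.
Proof.
move=> al aB; apply/ler_addgt0Pr => eps eps0; have [N H] := al eps eps0.
have := H N (leqnn N); rewrite cabsB => h.
have := cabsD (l - \sum_(i < N) a i) (\sum_(i < N) a i); rewrite subrK.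
have := cabs_sum (index_enum 'I_N) predT (fun i : 'I_N => a i); have := aB N.
by lra.
Qed.

Lemma has_sum_stationary a l N :
  (forall n, (N <= n)%N -> \sum_(i < n) a i = l) -> has_sum a l.
Proof.
by move=> aN eps eps0; exists N => n /aN ->; rewrite subrr cabs0 ltW.
Qed.

Lemma has_sum_unique a l m : has_sum a l -> has_sum a m -> l = m.
Proof.
move=> al am; apply/eqP; rewrite -subr_eq0 -cabs_eq0 eq_le cabs_ge0 andbT.
apply/ler_addgt0Pr => eps eps0; rewrite add0r; have e2 : 0 < eps / 2 by lra.
have [N1 H1] := al _ e2; have [N2 H2] := am _ e2.
have h1 := H1 _ (leq_maxl N1 N2); have h2 := H2 _ (leq_maxr N1 N2).
rewrite cabsB in h1; move: h1 h2; set s := \sum_(i < _) _ => h1 h2.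
by have := cabsD (l - s) (s - m); rewrite addrA subrK; lra.
Qed.

Lemma abs_Re_le_cabs (z : R[i]) : `|complex.Re z| <= cabs z.
Proof. by rewrite -lecR -normC_cabs normc_ge_Re. Qed.

Lemma cabs_le_Re_Im (z : R[i]) : cabs z <= `|complex.Re z| + `|complex.Im z|.
Proof.
rewrite [z in X in X <= _]complexE; apply: le_trans (cabsD _ _) _.
rewrite cabsM !cabs_real (_ : cabs 'i%C = 1) ?mul1r //.
by rewrite /cabs normc_def /= expr0n /= add0r expr1n sqrtr1.
Qed.

Lemma abs_Im_le_cabs (z : R[i]) : `|complex.Im z| <= cabs z.
Proof.
by rewrite /cabs normc_def /= -sqrtr_sqr ler_wsqrtr // lerDr sqr_ge0.
Qed.

Lemma real_series_cvg (x : nat -> R) (B : R) : (forall n, \sum_(i < n) `|x i| <= B) ->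
  exists l : R, forall eps : R, 0 < eps -> exists N, forall n, (N <= n)%N ->
    `|\sum_(i < n) x i - l| <= eps.
Proof.
move=> xB; have xcvg : cvgn (series x).
  apply: normed_cvg; apply: nondecreasing_is_cvgn.
    apply/nondecreasing_seqP => n.
    change (\sum_(0 <= k < n) `|x k| <= \sum_(0 <= k < n.+1) `|x k|).
    by rewrite big_nat_recr //= lerDl.
  exists B => _ [n _ <-]; change (\sum_(0 <= k < n) `|x k| <= B); by rewrite big_mkord.
exists (limn (series x)) => eps eps0.
have /cvgrPdist_le /(_ eps eps0) [N _ H] := xcvg.
by exists N => n Nn; have := H n Nn; rewrite distrC seriesEnat /= big_mkord.
Qed.

(** Completeness of [R], applied to the real and imaginary parts. *)
Lemma bounded_has_sum a (B : R) : (forall n, \sum_(i < n) cabs (a i) <= B) ->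
  exists l, has_sum a l.
Proof.
move=> aB.
have [|x xP] := @real_series_cvg (fun i => complex.Re (a i)) B.
  by move=> n; apply: le_trans (aB n); apply: ler_sum => i _; apply: abs_Re_le_cabs.
have [|y yP] := @real_series_cvg (fun i => complex.Im (a i)) B.
  by move=> n; apply: le_trans (aB n); apply: ler_sum => i _; apply: abs_Im_le_cabs.
exists (x +i* y)%C => eps eps0; have e2 : 0 < eps / 2 by lra.
have [N1 H1] := xP _ e2; have [N2 H2] := yP _ e2.
exists (maxn N1 N2) => n; rewrite geq_max => /andP[/H1 h1 /H2 h2].
apply: le_trans (cabs_le_Re_Im _) _; rewrite !raddfB /= !raddf_sum /=; lra.
Qed.

End Series.

Section Entire.
Context {R : realType}.
Implicit Types (p q : {poly R[i]}) (z h : R[i]) (r : R).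

(** The value at [r] of the polynomial with coefficients [cabs p`_i]. It bounds
    not only [p] on the disc of radius [r] but also, at [r + 1], the derivative
    and the second-order Taylor remainder. *)
Definition majorant p r : R := \sum_(i < size p) cabs p`_i * r ^+ i.

Lemma majorant_ge0 p r : 0 <= r -> 0 <= majorant p r.
Proof. by move=> r0; apply: sumr_ge0 => i _; rewrite mulr_ge0 ?cabs_ge0 ?exprn_ge0. Qed.

Lemma majorant_homo p r s : 0 <= r -> r <= s -> majorant p r <= majorant p s.
Proof.
move=> r0 rs; apply: ler_sum => i _; rewrite ler_wpM2l ?cabs_ge0 //.
by rewrite lerXn2r // nnegrE (le_trans r0).
Qed.

Lemma cabs_horner_le p z r : cabs z <= r -> cabs p.[z] <= majorant p r.
Proof.
move=> zr; rewrite horner_coef; apply: le_trans (cabs_sum _ _ _) _.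
apply: ler_sum => i _; rewrite cabsM cabsX ler_wpM2l ?cabs_ge0 //.
by rewrite lerXn2r // nnegrE ?cabs_ge0 // (le_trans (cabs_ge0 z)).
Qed.

Lemma majorant_XnM p k r : majorant ('X^k * p) r = r ^+ k * majorant p r.
Proof.
have [->|p0] := eqVneq p 0; first by rewrite mulr0 /majorant size_poly0 !big_ord0 mulr0.
rewrite /majorant mulrC size_mulXn // big_split_ord /= big1 ?add0r => [|i _].
  rewrite mulr_sumr; apply: eq_bigr => i _.
  by rewrite coefMXn ltnNge leq_addr /= addKn exprD mulrCA.
by rewrite coefMXn ltn_ord cabs0 mul0r.
Qed.

Lemma majorantZ p c r : majorant (c *: p) r = cabs c * majorant p r.
Proof.
have [->|c0] := eqVneq c 0.
  by rewrite scale0r cabs0 mul0r /majorant size_poly0 big_ord0.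
rewrite /majorant size_scale // mulr_sumr; apply: eq_bigr => i _.
by rewrite coefZ cabsM mulrA.
Qed.

(** The real numbers [(r+1)^i - r^i - i r^(i-1)] satisfy with equality the
    recursion that bounds the second-order Taylor remainder of [z^i]. *)
Lemma taylor2_monomial z h r i : cabs z <= r -> cabs h <= 1 ->
  cabs ((z + h) ^+ i - z ^+ i - h * (i%:R * z ^+ i.-1)) <=
    cabs h ^+ 2 * ((r + 1) ^+ i - r ^+ i - i%:R * r ^+ i.-1) /\
  0 <= (r + 1) ^+ i - r ^+ i - i%:R * r ^+ i.-1.
Proof.
move=> zr h1; have r0 : 0 <= r := le_trans (cabs_ge0 z) zr.
elim: i => [|i [IH1 IH2]].
  by rewrite !expr0 !subrr !mul0r mulr0 !subr0 cabs0 mulr0.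
have predS (S : comNzRingType) (x : S) : i%:R * x ^+ i = x * (i%:R * x ^+ i.-1).
  by case: i {IH1 IH2} => [|i]; rewrite ?mul0r ?mulr0 // exprS mulrCA.
have zE : (z + h) ^+ i.+1 - z ^+ i.+1 - h * (i.+1%:R * z ^+ i.+1.-1) =
    (z + h) * ((z + h) ^+ i - z ^+ i - h * (i%:R * z ^+ i.-1)) + h ^+ 2 * (i%:R * z ^+ i.-1).
  rewrite /= -natr1 mulrDl predS !exprS mul1r.
  by move: (_ * z ^+ i.-1) ((z + h) ^+ i) (z ^+ i) => A B C; ring.
have rE : (r + 1) ^+ i.+1 - r ^+ i.+1 - i.+1%:R * r ^+ i.+1.-1 =
    (r + 1) * ((r + 1) ^+ i - r ^+ i - i%:R * r ^+ i.-1) + i%:R * r ^+ i.-1.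
  rewrite /= -natr1 mulrDl predS !exprS mul1r.
  by move: (_ * r ^+ i.-1) ((r + 1) ^+ i) (r ^+ i) => A B C; ring.
have e0 : 0 <= i%:R * r ^+ i.-1 by rewrite mulr_ge0 ?exprn_ge0.
rewrite zE rE; split; last by rewrite addr_ge0 // mulr_ge0 // addr_ge0.
apply: le_trans (cabsD _ _) _; rewrite [X in _ <= X]mulrDr lerD //.
  rewrite cabsM [X in _ <= X]mulrCA; apply: ler_pM => //; rewrite ?cabs_ge0 //.
  by apply: le_trans (cabsD _ _) _; rewrite lerD.
rewrite cabsM cabsX ler_wpM2l ?exprn_ge0 ?cabs_ge0 // cabsM cabs_nat cabsX ler_wpM2l //.
by rewrite lerXn2r // nnegrE ?cabs_ge0.
Qed.

Lemma horner_deriv_coef p z :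
  p^`().[z] = \sum_(i < size p) p`_i * (i%:R * z ^+ i.-1).
Proof.
rewrite (@horner_coef_wide _ (size p).-1 p^`() z (size_poly _ _)).
case: (size p) => [|n]; first by rewrite !big_ord0.
rewrite big_ord_recl /= mul0r mulr0 add0r; apply: eq_bigr => i _.
by rewrite coef_deriv /bump /= add1n mulr_natl mulrnAr mulrnAl.
Qed.

Lemma taylor2_le p z h r : cabs z <= r -> cabs h <= 1 ->
  cabs (p.[z + h] - p.[z] - h * p^`().[z]) <= cabs h ^+ 2 * majorant p (r + 1).
Proof.
move=> zr h1; have r0 : 0 <= r := le_trans (cabs_ge0 z) zr.
rewrite horner_deriv_coef !horner_coef mulr_sumr -!sumrB.
apply: le_trans (cabs_sum _ _ _) _; rewrite mulr_sumr; apply: ler_sum => i _.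
rewrite [h * _]mulrCA -!mulrBr cabsM [X in _ <= X]mulrCA ler_wpM2l ?cabs_ge0 //.
have [le_i ge0_i] := taylor2_monomial i zr h1.
apply: le_trans le_i _; rewrite ler_wpM2l ?exprn_ge0 ?cabs_ge0 //.
by rewrite -addrA gerDl -opprD oppr_le0 addr_ge0 // ?mulr_ge0 ?exprn_ge0.
Qed.

Lemma cabs_deriv_le p z r : cabs z <= r -> cabs p^`().[z] <= majorant p (r + 1).
Proof.
move=> zr; have r0 : 0 <= r := le_trans (cabs_ge0 z) zr.
rewrite horner_deriv_coef; apply: le_trans (cabs_sum _ _ _) _; apply: ler_sum => i _.
rewrite cabsM ler_wpM2l ?cabs_ge0 // cabsM cabs_nat cabsX.
apply: (@le_trans _ _ (i%:R * r ^+ i.-1)).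
  by rewrite ler_wpM2l // lerXn2r // nnegrE ?cabs_ge0.
have z0 : cabs (0 : R[i]) <= r by rewrite cabs0.
have h0 : cabs (0 : R[i]) <= 1 by rewrite cabs0.
have [_] := taylor2_monomial i z0 h0; rewrite subr_ge0 => le_i.
by apply: le_trans le_i _; rewrite gerDl oppr_le0 exprn_ge0.
Qed.

Definition entire (f : R[i] -> R[i]) := forall z, differentiable f z.

Lemma differentiable_second_order (f : R[i] -> R[i]) z (d : R[i]) (S : R) :
    (forall h, cabs h <= 1 -> cabs (f (z + h) - f z - h * d) <= cabs h ^+ 2 * S) ->
  differentiable f z.
Proof.
move=> fz; apply/derivable1_diffP; apply/cvg_ex; exists d.
apply/cvgrPdist_le => /= eps eps0.
have e0 : 0 < cabs eps by rewrite cabs_gt0 gt_eqF.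
have epsE : eps = (cabs eps)%:C by rewrite -normC_cabs gtr0_norm.
pose del : R := Num.min 1 (cabs eps / (`|S| + 1)).
have S1 : 0 < `|S| + 1 by rewrite ltr_wpDl.
have del0 : 0 < del by rewrite lt_min ltr01 divr_gt0.
near=> t.
have t0 : t != 0 by near: t; exact: nbhs_dnbhs_neq.
have tdel : cabs t < del.
  rewrite -ltcR -normC_cabs; near: t; apply: dnbhs0_lt; rewrite ltcR; exact: del0.
have [t1 te] : cabs t < 1 /\ cabs t < cabs eps / (`|S| + 1).
  by move: tdel; rewrite lt_min => /andP.
rewrite epsE normC_cabs lecR.
have -> : d - t^-1 *: (f (t *: 1 + z) - f z) = - (t^-1 * (f (z + t) - f z - t * d)).
  rewrite -[t *: 1]/(t * 1) -[t^-1 *: _]/(t^-1 * _) mulr1 [t + z]addrC.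
  by rewrite [in RHS]mulrBr mulKf // opprB.
rewrite cabsN cabsM cabsV ler_pdivrMl ?cabs_gt0 //.
apply: le_trans (fz t (ltW t1)) _; rewrite expr2 -mulrA ler_wpM2l ?cabs_ge0 //.
move: te; rewrite ltr_pdivlMr // => te; apply: le_trans (ltW te).
by rewrite ler_wpM2l ?cabs_ge0 // (le_trans (ler_norm S)) // lerDl.
Unshelve. all: by end_near. Qed.

End Entire.

Section Interpolation.
Context {R : realType}.

(** Weierstrass's theorem for series of polynomials: convergence of the
    majorants on all discs makes the Taylor estimates summable. *)
Lemma entire_series (p : nat -> {poly R[i]}) :
    (forall r : R, 0 <= r -> exists B, forall n, \sum_(i < n) majorant (p i) r <= B) ->
  exists f, entire f /\ forall z, has_sum (fun i => (p i).[z]) (f z).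
Proof.
move=> bounded.
have /choice [f fP] z : exists l, has_sum (fun i => (p i).[z]) l.
  have [B BP] := bounded _ (cabs_ge0 z); apply: (@bounded_has_sum _ _ B) => n.
  by apply: le_trans (BP n); apply: ler_sum => i _; apply: cabs_horner_le.
exists f; split=> // z.
have r1 : 0 <= cabs z + 1 by rewrite addr_ge0 ?cabs_ge0.
have [B BP] := bounded _ r1.
have [d dP] : exists d, has_sum (fun i => (p i)^`().[z]) d.
  apply: (@bounded_has_sum _ _ B) => n.
  by apply: le_trans (BP n); apply: ler_sum => i _; apply: cabs_deriv_le.
apply: (@differentiable_second_order R f z d B) => h h1.
have sumh : has_sum (fun i => (p i).[z + h] - (p i).[z] - h * (p i)^`().[z])
    (f (z + h) - f z - h * d).
  have := has_sumD (has_sumD (fP (z + h)) (has_sumZ (-1) (fP z))) (has_sumZ (- h) dP).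
  rewrite mulN1r mulNr; congr (has_sum _ _).
  by apply/funext => i; rewrite mulN1r mulNr.
apply: (has_sum_le sumh) => n.
apply: le_trans (ler_wpM2l (exprn_ge0 _ (cabs_ge0 h)) (BP n)).
by rewrite mulr_sumr; apply: ler_sum => i _; apply: taylor2_le.
Qed.

(** A correction of the current sum [P] at the node [z k], vanishing at the
    earlier nodes; the factor [X^d] makes it negligible on half the disc. *)
Lemma interpolation_step (z w : nat -> R[i]) (P : {poly R[i]}) k :
    injective z -> z k != 0 ->
  exists p : {poly R[i]}, [/\ forall l, (l < k)%N -> p.[z l] = 0,
    P.[z k] + p.[z k] = w k & majorant p (cabs (z k) / 2) <= 2^-1 ^+ k].
Proof.
move=> z_inj zk0; pose Q := \prod_(l < k) ('X - (z l)%:P).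
have Qk : Q.[z k] != 0.
  rewrite horner_prod; apply/prodf_neq0 => l _; rewrite hornerXsubC subr_eq0.
  by apply/eqP => /z_inj kl; have := ltn_ord l; rewrite -kl ltnn.
pose a := (w k - P.[z k]) / Q.[z k].
pose C := cabs a * majorant Q (cabs (z k) / 2).
have h0 : 0 <= cabs (z k) / 2 by rewrite divr_ge0 ?cabs_ge0.
have C0 : 0 <= C by rewrite mulr_ge0 ?cabs_ge0 ?majorant_ge0.
have [d Cd] : exists d, C * 2^-1 ^+ d <= 2^-1 ^+ k.
  exists (k + Num.bound C)%N; rewrite exprD mulrCA -[X in _ <= X]mulr1.
  rewrite ler_wpM2l ?exprn_ge0 // exprVn ler_pdivrMr ?exprn_gt0 // mul1r.
  apply: le_trans (ltW (archi_boundP C0)) _.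
  by rewrite -natrX ler_nat ltnW // ltn_expl.
exists ((a / z k ^+ d) *: ('X^d * Q)); split=> [l lk||].
- rewrite hornerZ hornerM horner_prod (bigD1 (Ordinal lk)) //=.
  by rewrite hornerXsubC subrr mul0r !mulr0.
- rewrite hornerZ hornerM hornerXn mulrA divfK ?expf_neq0 // /a divfK //.
  by rewrite addrC subrK.
rewrite majorantZ majorant_XnM cabsM cabsV cabsX expr_div_n.
have zd : cabs (z k) ^+ d != 0 by rewrite expf_neq0 // gt_eqF ?cabs_gt0.
apply: le_trans Cd; rewrite /C exprVn le_eqVlt; apply/orP; left; apply/eqP.
by rewrite [_ / 2 ^+ d * _]mulrC !mulrA; congr (_ / _); rewrite mulrC mulrA mulrA; field.
Qed.

(** The sum of the successive corrections: at [z k] the corrections after the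
    [k]-th vanish, and on a disc all but finitely many are below [2^-i]. *)
Lemma entire_interpolation (z w : nat -> R[i]) :
    injective z -> (forall k, z k != 0) ->
    (forall B : R, exists N, forall k, (N <= k)%N -> B <= cabs (z k)) ->
  exists f, entire f /\ forall k, f (z k) = w k.
Proof.
move=> z_inj z0 z_infty.
have /choice [g gP] (kP : nat * {poly R[i]}) := @interpolation_step z w kP.2 kP.1 z_inj (z0 _).
pose P := fix P k := if k is k'.+1 then P k' + g (k', P k') else 0.
pose p k := g (k, P k).
have Psum k : P k = \sum_(i < k) p i.
  by elim: k => [|k IH]; rewrite ?big_ord0 // big_ord_recr /= -IH.
have [|f [f_entire fP]] := @entire_series p.
  move=> r r0; have [N NP] := z_infty (2 * r).
  exists (\sum_(i < N) majorant (p i) r + 2) => n.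
  have tail m : \sum_(i < m) majorant (p (N + i)%N) r <= 2 - 2 * 2^-1 ^+ m.
    elim: m => [|m IH]; first by rewrite big_ord0 expr0 mulr1 subrr.
    rewrite big_ord_recr /=; have [_ _ small] := gP ((N + m)%N, P (N + m)%N).
    have : majorant (p (N + m)%N) r <= 2^-1 ^+ m.
      apply: le_trans (le_trans (majorant_homo _ r0 _) small) _.
        by rewrite ler_pdivlMr // mulrC NP // leq_addr.
      by rewrite exprD ler_piMl ?exprn_ge0 // exprn_ile1 // invf_le1 // ler1n.
    move: IH; rewrite exprS; lra.
  have ge0 m : 0 <= \sum_(i < m) majorant (p (N + i)%N) r.
    by apply: sumr_ge0 => i _; apply: majorant_ge0.
  have e0 m : 0 <= (2^-1 : R) ^+ m by rewrite exprn_ge0.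
  have [nN|/ltnW Nn] := leqP n N.
    rewrite -(subnKC nN) big_split_ord /= -addrA lerDl addr_ge0 //.
    by apply: sumr_ge0 => i _; apply: majorant_ge0.
  rewrite -(subnKC Nn) big_split_ord /= lerD2l.
  by have := tail (n - N)%N; have := e0 (n - N)%N; lra.
exists f; split=> // k; apply: has_sum_unique (fP (z k)) _.
apply: (@has_sum_stationary _ _ _ k.+1) => n; elim: n => // n IH.
rewrite leq_eqVlt => /orP[/eqP [<-]|kn].
  rewrite big_ord_recr /= -horner_sum -Psum.
  by have [_] := gP (k, P k).
rewrite big_ord_recr /= (IH kn).
have [vanish _ _] := gP (n, P n).
by rewrite [X in _ + X](vanish k kn) addr0.
Qed.

End Interpolation.

(** * Holomorphic maps into SL *)

Section MatrixDifferentiability.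
Context {R : realType} {V : normedModType R[i]}.

Lemma differentiable_mx m n (F : V -> 'M[R[i]]_(m, n)) x :
  (forall i j, differentiable (fun y => F y i j) x) -> differentiable F x.
Proof.
move=> Fij; have -> : F = \sum_(i < m) \sum_(j < n) (fun y => F y i j *: delta_mx i j).
  apply/funext => y; rewrite fct_sumE [LHS]matrix_sum_delta; apply: eq_bigr => i _.
  by rewrite fct_sumE.
apply: differentiable_sum => i; apply: differentiable_sum => j.
exact: differentiableZl.
Qed.

Lemma differentiable_entry m n (F : V -> 'M[R[i]]_(m, n)) x i j :
  differentiable F x -> differentiable (fun y => F y i j) x.
Proof.
by move=> Fx; apply: (@differentiable_comp _ _ _ _ F (fun M : 'M[R[i]]_(m, n) => M i j)) => //;
   apply: differentiable_coord.
Qed.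

Lemma differentiable_mulmx m n p (F : V -> 'M[R[i]]_(m, n)) (G : V -> 'M[R[i]]_(n, p)) x :
  differentiable F x -> differentiable G x -> differentiable (fun y => F y *m G y) x.
Proof.
move=> Fx Gx; apply: differentiable_mx => i j.
rewrite (_ : (fun y => _) = \sum_(k < n) (fun y => F y i k * G y k j)).
  apply: differentiable_sum => k.
  by apply: differentiableM; apply: differentiable_entry.
by apply/funext => y; rewrite fct_sumE mxE.
Qed.

End MatrixDifferentiability.

Section InterpolationSL.
Context {R : realType}.

Definition entire_mx m n (F : R[i] -> 'M[R[i]]_(m, n)) := forall t, differentiable F t.

Lemma entire_mxP m n (F : R[i] -> 'M[R[i]]_(m, n)) :
  (forall i j, entire (fun t => F t i j)) -> entire_mx F.
Proof. by move=> Fij t; apply: differentiable_mx => i j; apply: Fij. Qed.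

Lemma entire_mx_entry m n (F : R[i] -> 'M[R[i]]_(m, n)) i j :
  entire_mx F -> entire (fun t => F t i j).
Proof. by move=> Fe t; apply: differentiable_entry. Qed.

Lemma entire_mx_cst m n (M : 'M[R[i]]_(m, n)) : entire_mx (fun=> M).
Proof. by move=> t; apply: differentiable_cst. Qed.

Lemma entire_mxN m n (F : R[i] -> 'M[R[i]]_(m, n)) : entire_mx F -> entire_mx (fun t => - F t).
Proof. by move=> Fe t; apply: differentiableN. Qed.

#[local] Hint Resolve entire_mx_cst entire_mxN : core.

Lemma entire_mxM m n p (F : R[i] -> 'M[R[i]]_(m, n)) (G : R[i] -> 'M[R[i]]_(n, p)) :
  entire_mx F -> entire_mx G -> entire_mx (fun t => F t *m G t).
Proof. by move=> Fe Ge t; apply: differentiable_mulmx. Qed.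

Lemma entire_block_mx m1 m2 n1 n2 (A : R[i] -> 'M[R[i]]_(m1, n1)) (B : R[i] -> 'M[R[i]]_(m1, n2))
    (C : R[i] -> 'M[R[i]]_(m2, n1)) (D : R[i] -> 'M[R[i]]_(m2, n2)) :
  entire_mx A -> entire_mx B -> entire_mx C -> entire_mx D ->
  entire_mx (fun t => block_mx (A t) (B t) (C t) (D t)).
Proof.
move=> Ae Be Ce De; apply: entire_mxP => i j; rewrite -(splitK i) -(splitK j).
case: (fintype.split i) => k; case: (fintype.split j) => l t /=;
  under eq_fun do rewrite ?block_mxEul ?block_mxEur ?block_mxEdl ?block_mxEdr;
  exact: entire_mx_entry.
Qed.

Definition free_nodes (z : nat -> R[i]) := forall w : nat -> R[i],
  exists f, entire f /\ forall k, f (z k) = w k.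

Lemma free_nodes_mx (z : nat -> R[i]) m n (W : nat -> 'M[R[i]]_(m, n)) : free_nodes z ->
  exists F, entire_mx F /\ forall k, F (z k) = W k.
Proof.
move=> zfree; have /choice [f fP] (p : 'I_m * 'I_n) := zfree (fun k => W k p.1 p.2).
exists (fun t => \matrix_(i, j) f (i, j) t); split=> [|k].
  by apply: entire_mxP => i j; under eq_fun do rewrite mxE; have [] := fP (i, j).
by apply/matrixP => i j; rewrite mxE; have [_ ->] := fP (i, j).
Qed.

(** The inverse [G] of [F] is carried along, since the automorphisms built from
    [F] need a holomorphic inverse. *)
Definition SL_interpolable (z : nat -> R[i]) m (M : nat -> 'M[R[i]]_m) :=
  exists F G, [/\ entire_mx F, entire_mx G, forall t, F t *m G t = 1%:M,
    forall t, \det (F t) = 1 & forall k, F (z k) = M k].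

Variable z : nat -> R[i].
Hypothesis zfree : free_nodes z.

Lemma SL_interpolableM m (M N : nat -> 'M[R[i]]_m) : SL_interpolable z M ->
  SL_interpolable z N -> SL_interpolable z (fun k => M k *m N k).
Proof.
move=> [F [F' [Fe F'e FF' detF FM]]] [G [G' [Ge G'e GG' detG GN]]].
exists (fun t => F t *m G t), (fun t => G' t *m F' t); split.
- exact: entire_mxM.
- exact: entire_mxM.
- by move=> t; rewrite mulmxA -(mulmxA (F t)) GG' mulmx1 FF'.
- by move=> t; rewrite det_mulmx detF detG mulr1.
- by move=> k; rewrite FM GN.
Qed.

Lemma SL_interpolable_lower m (c : nat -> 'cV[R[i]]_m) :
  SL_interpolable z (fun k => block_mx 1%:M 0 (c k) 1%:M : 'M[R[i]]_(1 + m)).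
Proof.
have [F [Fe FM]] := free_nodes_mx c zfree.
exists (fun t => block_mx 1%:M 0 (F t) 1%:M), (fun t => block_mx 1%:M 0 (- F t) 1%:M).
split; [by apply: entire_block_mx; auto | by apply: entire_block_mx; auto | | |].
- by move=> t; cbv beta; rewrite mulmx_block !mul1mx !mul0mx !mulmx1 !mulmx0 ?addr0 ?add0r subrr -scalar_mx_block.
- by move=> t; rewrite det_lblock !det1 mulr1.
- by move=> k; rewrite FM.
Qed.

Lemma SL_interpolable_upper m (r : nat -> 'rV[R[i]]_m) :
  SL_interpolable z (fun k => block_mx 1%:M (r k) 0 1%:M : 'M[R[i]]_(1 + m)).
Proof.
have [F [Fe FM]] := free_nodes_mx r zfree.
exists (fun t => block_mx 1%:M (F t) 0 1%:M), (fun t => block_mx 1%:M (- F t) 0 1%:M).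
split; [by apply: entire_block_mx; auto | by apply: entire_block_mx; auto | | |].
- by move=> t; cbv beta; rewrite mulmx_block !mul1mx !mul0mx !mulmx1 !mulmx0 ?addr0 ?add0r addNr -scalar_mx_block.
- by move=> t; rewrite det_ublock !det1 mulr1.
- by move=> k; rewrite FM.
Qed.

Lemma SL_interpolable_block m (M : nat -> 'M[R[i]]_m) : SL_interpolable z M ->
  SL_interpolable z (fun k => block_mx 1%:M 0 0 (M k) : 'M[R[i]]_(1 + m)).
Proof.
move=> [F [F' [Fe F'e FF' detF FM]]].
exists (fun t => block_mx 1%:M 0 0 (F t)), (fun t => block_mx 1%:M 0 0 (F' t)).
split; [by apply: entire_block_mx; auto | by apply: entire_block_mx; auto | | |].
- by move=> t; cbv beta; rewrite mulmx_block !mul1mx !mul0mx !mulmx0 ?addr0 ?add0r FF' -scalar_mx_block.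
- by move=> t; rewrite det_lblock det1 mul1r.
- by move=> k; rewrite FM.
Qed.

End InterpolationSL.

(** Clearing the first row and column by unipotents: make the first column
    nonzero below the corner, use it to turn the corner into 1, then pivot. *)
Lemma unipotent_elimination (K : fieldType) m (M : 'M[K]_(1 + m.+1)) : \det M = 1 ->
  exists (x c : 'cV[K]_m.+1) (y b : 'rV[K]_m.+1) (N : 'M[K]_m.+1), \det N = 1 /\
    M = block_mx 1%:M 0 x 1%:M *m block_mx 1%:M y 0 1%:M *m block_mx 1%:M 0 c 1%:M *m
        block_mx 1%:M 0 0 N *m block_mx 1%:M b 0 1%:M.
Proof.
move=> detM; pose a := M 0 0; pose c0 := dlsubmx M.
have Ma : ulsubmx M = a%:M.
  by apply/matrixP => i j; rewrite !ord1 !mxE eqxx mulr1n; congr (M _ _); apply: val_inj.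
have [x x0] : exists x : 'cV[K]_m.+1, c0 - a *: x != 0.
  have [c00|c00] := eqVneq c0 0; last by exists 0; rewrite scaler0 subr0.
  exists (const_mx 1); rewrite c00 sub0r oppr_eq0 scaler_eq0 negb_or.
  apply/andP; split; last by apply/eqP => /matrixP /(_ 0 0) /eqP; rewrite !mxE oner_eq0.
  apply/eqP => a0; move: detM; rewrite -(submxK M) Ma a0 -/c0 c00.
  rewrite (_ : (0 : K)%:M = 0); last by apply/matrixP => i j; rewrite !mxE mul0rn.
  by rewrite det_ublock det0 mul0r => /eqP; rewrite eq_sym oner_eq0.
pose c := c0 - a *: x.
have [i ci] : exists i, c i 0 != 0.
  apply: contrapT => noi; move/eqP: x0; apply; apply/colP => i; rewrite [RHS]mxE.
  by apply/eqP; apply: contrapT => /negP ci; apply: noi; exists i.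
pose y : 'rV[K]_m.+1 := ((a - 1) / c i 0) *: delta_mx 0 i.
have yc : y *m c = (a - 1)%:M.
  by rewrite /y -scalemxAl -rowE; apply/matrixP => k l; rewrite !ord1 mxE [row i c 0 0]mxE divfK // mxE eqxx mulr1n.
pose b0 := ursubmx M; pose d0 := drsubmx M - x *m b0.
pose b := b0 - y *m d0.
exists x, c, y, b, (d0 - c *m b).
have E : M = block_mx 1%:M 0 x 1%:M *m block_mx 1%:M y 0 1%:M *m block_mx 1%:M 0 c 1%:M *m
        block_mx 1%:M 0 0 (d0 - c *m b) *m block_mx 1%:M b 0 1%:M.
  rewrite -!mulmxA !mulmx_block !(mul1mx, mul0mx, mulmx1, mulmx0, addr0, add0r).
  have e1 : 1%:M + y *m c = ulsubmx M.
    by rewrite yc Ma -raddfD /= addrC subrK.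
  have e2 : c *m b + (d0 - c *m b) = d0 by rewrite addrC subrK.
  have e3 : b + y *m d0 = ursubmx M by rewrite subrK.
  have e4 : x *m ulsubmx M + c = dlsubmx M by rewrite Ma mul_mx_scalar addrC subrK.
  have e5 : x *m ursubmx M + d0 = drsubmx M by rewrite addrC subrK.
  by rewrite e2 e1 e3 e4 e5 submxK.
split=> //; move: detM; rewrite {1}E !det_mulmx !det_lblock !det_ublock !det1.
by rewrite !mul1r !mulr1.
Qed.

(** By induction on the size: each unipotent factor of the elimination has free
    entries, and interpolable sequences are closed under products. *)
Lemma SL_interpolation (R : realType) (z : nat -> R[i]) m (M : nat -> 'M[R[i]]_m) :
  free_nodes z -> (forall k, \det (M k) = 1) -> SL_interpolable z M.
Proof.
move=> zfree; case: m M => [|m] M detM.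
  exists (fun=> 1%:M), (fun=> 1%:M); split; do ?exact: entire_mx_cst.
  - by move=> t; rewrite mulmx1.
  - by move=> t; rewrite det1.
  - by move=> k; apply/matrixP => [[]].
elim: m M detM => [|m IH] M detM.
  exists (fun=> 1%:M), (fun=> 1%:M); split; do ?exact: entire_mx_cst.
  - by move=> t; rewrite mulmx1.
  - by move=> t; rewrite det1.
  - by move=> k; have := detM k; rewrite det_mx11 => M1; apply/matrixP => i j; rewrite !ord1 M1 mxE.
have /choice [x /choice [c /choice [y /choice [b /choice [N MN]]]]] k :=
  unipotent_elimination (detM k).
have -> : M = (fun k => block_mx 1%:M 0 (x k) 1%:M *m block_mx 1%:M (y k) 0 1%:M *m
    block_mx 1%:M 0 (c k) 1%:M *m block_mx 1%:M 0 0 (N k) *m block_mx 1%:M (b k) 0 1%:M).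
  by apply/funext => k; have [] := MN k.
have detN k : \det (N k) = 1 by have [] := MN k.
apply: SL_interpolableM (SL_interpolable_upper zfree b).
apply: SL_interpolableM (SL_interpolable_block (IH N detN)).
apply: SL_interpolableM (SL_interpolable_lower zfree c).
exact: SL_interpolableM (SL_interpolable_lower zfree x) (SL_interpolable_upper zfree y).
Qed.

(** * Automorphisms of SL *)

Section Automorphisms.
Context {R : realType} {V : normedModType R[i]}.
Implicit Types (X : set V) (f g : V -> V).

Lemma automorphism_of_differentiable X f g :
    set_fun X X f -> set_fun X X g -> {in X, cancel f g} -> {in X, cancel g f} ->
    (forall x, differentiable f x) -> (forall x, differentiable g x) ->
  automorphism X f.
Proof.
move=> fX gX fg gf df dg; exists g; split=> //; split=> x _.
  by exists f; split; apply: nearW.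
by exists g; split; apply: nearW.
Qed.

Lemma holomorphic_on_comp X f g : set_fun X X f ->
  holomorphic_on X f -> holomorphic_on X g -> holomorphic_on X (g \o f).
Proof.
move=> fX hf hg x Xx; have [F [dF fF]] := hf x Xx.
have [G [dG gG]] := hg (f x) (fX x Xx).
have Fx : F x = f x by rewrite (nbhs_singleton fF).
have Fc : {for x, continuous F} := differentiable_continuous (nbhs_singleton dF).
have FG (P : V -> Prop) : (\forall y \near f x, P y) -> \forall y \near x, P (F y).
  by rewrite -Fx => /Fc.
exists (G \o F); split.
  near=> y; apply: differentiable_comp; first by near: y; exact: dF.
  by near: y; exact: (FG _ dG).
near=> y => Xy /=.
have fyE : f y = F y by move: Xy; near: y; exact: fF.
rewrite fyE; have := fX y Xy; rewrite /= fyE; near: y; exact: (FG _ gG).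
Unshelve. all: by end_near. Qed.

Lemma automorphism_comp X f g : automorphism X f -> automorphism X g -> automorphism X (g \o f).
Proof.
move=> [f' [fX f'X ff' f'f [hf hf']]] [g' [gX g'X gg' g'g [hg hg']]].
exists (f' \o g'); split.
- by move=> x Xx; apply/gX/fX.
- by move=> x Xx; apply/f'X/g'X.
- by move=> x Xx /=; rewrite gg' ?ff' //; apply/mem_set/fX/set_mem.
- by move=> x Xx /=; rewrite f'f ?g'g //; apply/mem_set/g'X/set_mem.
- by split; apply: holomorphic_on_comp.
Qed.

Lemma holomorphic_on_continuous X f : holomorphic_on X f -> {within X, continuous f}.
Proof.
move=> hf; apply/subspace_continuousP => x Xx P Pfx.
have [F [dF fF]] := hf x Xx.
have Fx : F x = f x by rewrite (nbhs_singleton fF).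
have Fc : {for x, continuous F} := differentiable_continuous (nbhs_singleton dF).
have PFx : nbhs (F x) P by rewrite Fx.
have PF : \forall y \near x, P (F y) := Fc _ PFx.
rewrite /nbhs /= /within /=; near=> y => Xy.
have fyE : f y = F y by move: Xy; near: y; exact: fF.
change (P (f y)); rewrite fyE; near: y; exact: PF.
Unshelve. all: by end_near. Qed.

End Automorphisms.

Section PivotMaps.
Context {R : realType}.

Lemma SL_mul (n : nat) (A M B : 'M[R[i]]_n) : \det A = 1 -> \det B = 1 -> SL _ n M ->
  SL _ n (A *m M *m B).
Proof. by rewrite /SL /= !det_mulmx => -> -> ->; rewrite !mulr1. Qed.

Lemma mulmx_automorphism n (P Q : 'M[R[i]]_n) : \det P = 1 -> \det Q = 1 ->
  automorphism (SL R[i] n) (fun M => P *m M *m Q).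
Proof.
move=> detP detQ.
have uP : P \in unitmx by rewrite unitmxE detP unitr1.
have uQ : Q \in unitmx by rewrite unitmxE detQ unitr1.
have dif (A B : 'M[R[i]]_n) M : differentiable (fun M : 'M[R[i]]_n => A *m M *m B) M.
  by apply: differentiable_mulmx => //; apply: differentiable_mulmx.
apply: (@automorphism_of_differentiable _ _ _ _ (fun M => invmx P *m M *m invmx Q)) => //.
- by move=> M; apply: SL_mul.
- by move=> M; apply: SL_mul; rewrite det_inv ?detP ?detQ invr1.
- by move=> M _; rewrite !mulmxA mulVmx // mul1mx mulmxK.
- by move=> M _; rewrite !mulmxA mulmxV // mul1mx mulmxKV.
Qed.

(** The multipliers depend on an entry that the multiplication preserves, so that
    they can be recovered from the image and divided out. *)
Lemma pivot_automorphism n (A A' B B' : R[i] -> 'M[R[i]]_n.+1) :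
    entire_mx A -> entire_mx A' -> entire_mx B -> entire_mx B' ->
    (forall t, A t *m A' t = 1%:M) -> (forall t, B t *m B' t = 1%:M) ->
    (forall t, \det (A t) = 1) -> (forall t, \det (B t) = 1) ->
    (forall t M, (A t *m M *m B t) 0 0 = M 0 0) ->
  automorphism (SL R[i] n.+1) (fun M => A (M 0 0) *m M *m B (M 0 0)).
Proof.
move=> Ae A'e Be B'e AA' BB' detA detB piv.
have A'A t : A' t *m A t = 1%:M by apply: mulmx1C.
have B'B t : B' t *m B t = 1%:M by apply: mulmx1C.
have piv' t M : (A' t *m M *m B' t) 0 0 = M 0 0.
  by rewrite -(piv t) !mulmxA AA' mul1mx -mulmxA B'B mulmx1.
have dif (C D : R[i] -> 'M[R[i]]_n.+1) M : entire_mx C -> entire_mx D ->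
    differentiable (fun M : 'M[R[i]]_n.+1 => C (M 0 0) *m M *m D (M 0 0)) M.
  move=> Ce De; apply: differentiable_mulmx; first apply: differentiable_mulmx => //.
  - by apply: (@differentiable_comp _ _ _ _ (fun M : 'M[R[i]]_n.+1 => M 0 0) C) => //; apply: differentiable_coord.
  - by apply: (@differentiable_comp _ _ _ _ (fun M : 'M[R[i]]_n.+1 => M 0 0) D) => //; apply: differentiable_coord.
have detA' t : \det (A' t) = 1.
  by have := congr1 determinant (AA' t); rewrite det_mulmx detA mul1r det1.
have detB' t : \det (B' t) = 1.
  by have := congr1 determinant (BB' t); rewrite det_mulmx detB mul1r det1.
apply: (@automorphism_of_differentiable R 'M[R[i]]_n.+1 (SL R[i] n.+1)
  (fun M => A (M 0 0) *m M *m B (M 0 0)) (fun M => A' (M 0 0) *m M *m B' (M 0 0))).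
- by move=> M; apply: SL_mul.
- by move=> M; apply: SL_mul.
- by move=> M _; rewrite piv !mulmxA A'A mul1mx -mulmxA BB' mulmx1.
- by move=> M _; rewrite piv' !mulmxA AA' mul1mx -mulmxA B'B mulmx1.
- by move=> M; apply: dif.
- by move=> M; apply: dif.
Qed.

(** Row and column operations through the pivot [z] reduce both matrices to
    their Schur complements, which have the same determinant [z^-1]. *)
Lemma pivot_double_coset (K : fieldType) n (M N : 'M[K]_(1 + n)) (z : K) :
    z != 0 -> M 0 0 = z -> N 0 0 = z -> \det M = 1 -> \det N = 1 ->
  exists (c : 'cV[K]_n) (r : 'rV[K]_n) (S : 'M[K]_n), \det S = 1 /\
    block_mx 1%:M 0 c S *m M *m block_mx 1%:M r 0 1%:M = N.
Proof.
move=> z0 Mz Nz detM detN.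
have ulE (L : 'M[K]_(1 + n)) : L 0 0 = z -> ulsubmx L = z%:M.
  by move=> <-; apply/matrixP => i j; rewrite !ord1 !mxE eqxx mulr1n; congr (L _ _); apply: val_inj.
pose schur (L : 'M[K]_(1 + n)) := drsubmx L - z^-1 *: (dlsubmx L *m ursubmx L).
have det_schur (L : 'M[K]_(1 + n)) : L 0 0 = z -> \det L = z * \det (schur L).
  move=> /ulE Lz; rewrite -{1}(submxK L) Lz.
  rewrite (_ : block_mx _ _ _ _ = block_mx 1%:M 0 (z^-1 *: dlsubmx L) 1%:M *m
      block_mx z%:M (ursubmx L) 0 (schur L)).
    by rewrite det_mulmx det_lblock det_ublock !det1 !mul1r det_scalar1.
  rewrite mulmx_block !(mul1mx, mul0mx, addr0) mul_mx_scalar scalerA divff // scale1r.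
  by rewrite -scalemxAl addrC /schur subrK.
have sM0 : \det (schur M) != 0.
  by apply/eqP => s0; move: detM; rewrite det_schur // s0 mulr0 => /eqP; rewrite eq_sym oner_eq0.
have sMu : schur M \in unitmx by rewrite unitmxE unitfE.
pose S := schur N *m invmx (schur M).
pose r := z^-1 *: (ursubmx N - ursubmx M).
pose c := z^-1 *: (dlsubmx N - S *m dlsubmx M).
exists c, r, S; split.
  rewrite /S det_mulmx det_inv; apply: (mulfI z0).
  rewrite mulrA -(det_schur N Nz) detN mulr1 -detM (det_schur M Mz) mulfK //.
pose M00 := ulE M Mz; pose N00 := ulE N Nz.
have lower : c *m z%:M + S *m dlsubmx M = dlsubmx N.
  by rewrite mul_mx_scalar scalerA divff // scale1r subrK.
have upper : z%:M *m r + ursubmx M = ursubmx N.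
  by rewrite mul_scalar_mx scalerA divff // scale1r subrK.
rewrite -[M in LHS]submxK M00 !mulmx_block !(mul1mx, mul0mx, mulmx1, mulmx0, addr0, add0r).
rewrite -[RHS]submxK N00 lower upper; congr (block_mx _ _ _ _).
have SM : S *m schur M = schur N by rewrite mulmxKV.
rewrite -[RHS](subrK (z^-1 *: (dlsubmx N *m ursubmx N))) -/(schur N) -SM /schur.
rewrite /r -scalemxAr !mulmxBr scalerBr.
rewrite -[in RHS]scalemxAr.
rewrite /c -scalemxAl mulmxBl scalerBr mulmxA.
by rewrite !addrA subrK addrAC -addrA [RHS]addrC.
Qed.

(** The factors moving [g k] to [h k] are values at [z k] of entire maps, which
    are then evaluated at the corner of the variable matrix. *)
Lemma move_with_pivot n (z : nat -> R[i]) (g h : nat -> 'M[R[i]]_(1 + n)) :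
    free_nodes z -> (forall k, z k != 0) ->
    (forall k, SL _ _ (g k)) -> (forall k, SL _ _ (h k)) ->
    (forall k, g k 0 0 = z k) -> (forall k, h k 0 0 = z k) ->
  exists psi, automorphism (SL R[i] (1 + n)) psi /\ forall k, psi (g k) = h k.
Proof.
move=> zfree z0 detg deth gz hz.
have /choice [c /choice [r /choice [S cosetP]]] k :=
  pivot_double_coset (z0 k) (gz k) (hz k) (detg k) (deth k).
have [C [Ce Cz]] := free_nodes_mx c zfree.
have [Q [Qe Qz]] := free_nodes_mx r zfree.
have detS k : \det (S k) = 1 by have [] := cosetP k.
have [F [G [Fe Ge FG detF FS]]] := SL_interpolation zfree detS.
exists (fun M : 'M[R[i]]_(1 + n) => block_mx 1%:M 0 (C (M 0 0)) (F (M 0 0)) *m M *m block_mx 1%:M (Q (M 0 0)) 0 1%:M).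
split; last by move=> k; rewrite gz Cz FS Qz; have [] := cosetP k.
pose A t : 'M[R[i]]_(1 + n) := block_mx 1%:M 0 (C t) (F t).
pose A' t : 'M[R[i]]_(1 + n) := block_mx 1%:M 0 (- (G t *m C t)) (G t).
pose B t : 'M[R[i]]_(1 + n) := block_mx 1%:M (Q t) 0 1%:M.
pose B' t : 'M[R[i]]_(1 + n) := block_mx 1%:M (- Q t) 0 1%:M.
have Ae : entire_mx A by apply: entire_block_mx => //; apply: entire_mx_cst.
have A'e : entire_mx A'.
  apply: entire_block_mx => //; try exact: entire_mx_cst.
  by apply: entire_mxN; apply: entire_mxM.
have Be : entire_mx B by apply: entire_block_mx => //; apply: entire_mx_cst.
have B'e : entire_mx B'.
  by apply: entire_block_mx => //; try exact: entire_mx_cst; apply: entire_mxN.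
have AA' t : A t *m A' t = 1%:M.
  rewrite mulmx_block !(mul1mx, mul0mx, mulmx1, mulmx0, addr0, add0r) FG.
  by rewrite mulmxN mulmxA FG mul1mx subrr -scalar_mx_block.
have BB' t : B t *m B' t = 1%:M.
  rewrite mulmx_block !(mul1mx, mul0mx, mulmx1, mulmx0, addr0, add0r).
  by rewrite addNr -scalar_mx_block.
have detA t : \det (A t) = 1 by rewrite det_lblock det1 mul1r.
have detB t : \det (B t) = 1 by rewrite det_ublock !det1 mul1r.
have piv t (M : 'M[R[i]]_(1 + n)) : (A t *m M *m B t) 0 0 = M 0 0.
  have e0 : 0 = lshift n 0 :> 'I_(1 + n) by apply: val_inj.
  rewrite -[M in LHS]submxK !mulmx_block !(mul1mx, mul0mx, mulmx1, mulmx0, addr0, add0r).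
  by rewrite [in LHS]e0 block_mxEul !mxE; congr (M _ _); apply: val_inj.
exact: (@pivot_automorphism n A A' B B').
Qed.

End PivotMaps.

(** * Compactness and discreteness in SL *)

Section Topology.
Context {R : realType}.

Lemma cabs_continuous : continuous (@cabs R : R[i] -> R).
Proof.
move=> z; apply: (proj2 (@cvgrPdist_lt _ R _ (nbhs z) _ (@cabs R) (cabs z))) => eps eps0; near=> w.
have zw : cabs (z - w) < eps.
  rewrite -ltcR -normC_cabs; near: w.
  by apply: (@cvgr_dist_lt _ R[i] _ (nbhs z) _ id z); rewrite ?ltcR //; exact: cvg_id.
apply: le_lt_trans zw; rewrite ler_norml.
have := cabsD (z - w) w; have := cabsD (w - z) z; rewrite !subrK (cabsB w z); lra.
Unshelve. all: by end_near. Qed.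

Lemma mxabs_continuous m n : continuous (@mxabs R m n : 'M[R[i]]_(m, n) -> R).
Proof.
apply: continuous_big => [|i _]; first exact: add_continuous.
apply: continuous_big => [|j _]; first exact: add_continuous.
move=> M; apply: (@continuous_comp _ _ _ (fun M : 'M[R[i]]_(m, n) => M i j) (@cabs R)).
  exact: coord_continuous.
exact: cabs_continuous.
Qed.

Lemma det_continuous n : continuous (fun M : 'M[R[i]]_n => \det M).
Proof.
apply: continuous_big => [|s _]; first exact: add_continuous.
have prodc (t : 'I_n -> 'I_n) : continuous (fun M : 'M[R[i]]_n => \prod_i M i (t i)).
  apply: continuous_big => [|i _]; first exact: mul_continuous.
  exact: coord_continuous.
move=> M; apply: (@cvgMr _ _ (nbhs M)); exact: (prodc _ M).
Qed.

Lemma real_complex_continuous : continuous (fun x : R => x%:C : R[i]).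
Proof.
move=> x; apply: (proj2 (@cvgrPdist_lt _ R[i] _ (nbhs x) _ (fun x : R => x%:C : R[i]) x%:C)) => eps eps0.
have e0 : 0 < cabs eps by rewrite cabs_gt0 gt_eqF.
near=> y.
have -> : eps = (cabs eps)%:C by rewrite -normC_cabs gtr0_norm.
rewrite -rmorphB /= normC_cabs cabs_real ltcR; near: y.
exact: (@cvgr_dist_lt _ R _ (nbhs x) _ id x (@cvg_id _ _) _ e0).
Unshelve. all: by end_near. Qed.

Lemma complex_box_compact (c : R) :
  compact [set z : R[i] | exists x y, [/\ -c <= x <= c, -c <= y <= c & z = x%:C + 'i%C * y%:C]].
Proof.
pose f (p : R * R) : R[i] := p.1%:C + 'i%C * p.2%:C.
have fc : continuous f.
  move=> p; apply: cvgD.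
    apply: (@continuous_comp _ _ _ fst (fun x : R => x%:C : R[i])); first exact: cvg_fst.
    exact: real_complex_continuous.
  apply: cvgMr; apply: (@continuous_comp _ _ _ snd (fun x : R => x%:C : R[i])); first exact: cvg_snd.
  exact: real_complex_continuous.
have box : compact (`[-c, c]%classic `*` `[-c, c]%classic : set (R * R)).
  by apply: compact_setX; apply: segment_compact.
have := continuous_compact (continuous_subspaceT fc) box; congr compact.
apply/seteqP; split => z /=.
  by move=> [[x y] [/= xc yc] <-]; exists x, y; rewrite !in_itv /= in xc yc.
by move=> [x [y [xc yc ->]]]; exists (x, y) => //; split; rewrite /= in_itv.
Qed.

Lemma mxabs_ball_compact n (c : R) : compact [set M : 'M[R[i]]_n | mxabs M <= c].
Proof.
pose K := [set z : R[i] | exists x y, [/\ -c <= x <= c, -c <= y <= c & z = x%:C + 'i%C * y%:C]].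
have boxc : compact [set v : 'rV[R[i]]_(n * n) | forall k, K (v ord0 k)].
  exact: (@rV_compact R[i] (n * n) (fun=> K) (fun=> @complex_box_compact c)).
have vc : continuous (vec_mx : 'rV[R[i]]_(n * n) -> 'M[R[i]]_n).
  move=> v; apply: differentiable_continuous; apply: differentiable_mx => i j.
  rewrite (_ : (fun y : 'rV[R[i]]_(n * n) => _) = (fun y => y 0 (mxvec_index i j))).
    exact: differentiable_coord.
  by apply/funext => y; rewrite -mxvecE vec_mxK.
have imc := continuous_compact (continuous_subspaceT vc) boxc; apply: (subclosed_compact _ imc).
  apply: (@closed_comp _ _ (@mxabs R n n) [set x | x <= c]); last exact: closed_le.
  by move=> M _; apply: mxabs_continuous.
move=> M /= Mc; exists (mxvec M); last exact: mxvecK.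
move=> k; case/mxvec_indexP: k => i j; rewrite mxvecE.
have Mij : cabs (M i j) <= c := le_trans (cabs_le_mxabs M i j) Mc.
exists (complex.Re (M i j)), (complex.Im (M i j)); rewrite -!ler_norml; split.
- exact: le_trans (abs_Re_le_cabs _) Mij.
- exact: le_trans (abs_Im_le_cabs _) Mij.
- exact: complexE.
Qed.

Lemma closed_SL n : closed (SL R[i] n).
Proof.
apply: (@closed_comp _ _ (fun M : 'M[R[i]]_n => \det M) [set 1]) => [M _|]; first exact: det_continuous.
by apply: accessible_closed_set1; apply: hausdorff_accessible; apply: norm_hausdorff.
Qed.

Lemma exhaustion_mxabs n : exhaustion (SL R[i] n) (@mxabs R n n).
Proof.
split=> [|M _|c]; last 1 first.
- by rewrite setIC; apply: compact_closedI; [apply: mxabs_ball_compact | apply: closed_SL].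
- exact: continuous_subspaceT (@mxabs_continuous n n).
- exact: mxabs_ge0.
Qed.

Lemma compact_mxabs_bounded n (K : set 'M[R[i]]_n) : compact K ->
  exists B : R, forall M, K M -> mxabs M <= B.
Proof.
move=> /(continuous_compact (continuous_subspaceT (@mxabs_continuous n n))) /compact_bounded.
move=> [B [_ BP]]; exists (B + 1) => M KM.
have := BP (B + 1); rewrite ltrDl ltr01 => /(_ isT (mxabs M)) h.
by apply: le_trans (ler_norm _) (h _); exists M.
Qed.

(** Were [D `&` K] infinite, a cluster point in [K] of the filter of its cofinite
    subsets would be a limit point of [D]. *)
Lemma discrete_compact_finite {T : topologicalType} (D K : set T) :
  compact K -> K `&` limit_point D = set0 -> finite_set (D `&` K).
Proof.
move=> Kc Klim; apply: contrapT => infDK.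
pose F : set_system T := [set A | finite_set ((D `&` K) `\` A)].
have FF : ProperFilter F.
  split; first by rewrite /F /= setD0.
  split=> [|A B FA FB|A B AB FA]; first by rewrite /F /= setDT; apply: finite_set0.
    by rewrite /F /= setDIr finite_setU.
  by apply: sub_finite_set FA; apply: setDS.
have FK : F K by rewrite /F /= setDE -setIA setICr setI0; apply: finite_set0.
have [p [Kp clp]] := Kc F FF FK.
have : ~ limit_point D p by move=> Dp; have : (K `&` limit_point D) p by []; rewrite Klim.
rewrite not_limit_pointE => -[U Up DU].
have Fp : F ((D `&` K) `\ p).
  apply: sub_finite_set (finite_set1 p) => x [DKx nx].
  by apply: contrapT => xp; apply: nx.
by have [x [[[Dx _] xp] Ux]] := clp _ _ Fp Up; apply/xp/DU.
Qed.

(** SL is exhausted by compact sets, each of which meets [D] in a finite set;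
    hence [D] is countable and any enumeration of it leaves them all. *)
Lemma discrete_SL_enum n (D : set 'M[R[i]]_n) : infinite_set D -> discrete_in (SL R[i] n) D ->
  exists g : nat -> 'M[R[i]]_n, [/\ injective g, range g = D &
    forall K, K `<=` SL R[i] n -> compact K -> exists N, forall k, (N <= k)%N -> ~ K (g k)].
Proof.
move=> Dinf [DS Dlim].
have fin K : K `<=` SL R[i] n -> compact K -> finite_set (D `&` K).
  move=> KS Kc; apply: discrete_compact_finite => //.
  by rewrite -subset0 -Dlim; apply: setSI.
have Dcount : countable D.
  apply: (@sub_countable _ _ D (\bigcup_(k : nat) (D `&` (SL R[i] n `&` [set M | mxabs M <= k%:R])))).
    apply: subset_card_le => M DM; exists (Num.bound (mxabs M)) => //; split=> //; split; first exact: DS.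
    by apply/ltW/archi_boundP/mxabs_ge0.
  apply: bigcup_countable => // k _; apply: finite_set_countable; apply: fin; first exact: subIsetl.
  by have [_ _] := exhaustion_mxabs n; apply.
have /card_set_bijP [g [gD ginj gsurj]] : ([set: nat] #= D)%card.
  by rewrite card_eq_sym; apply: eq_card_nat.
have g_inj : injective g by move=> k l; apply: ginj; rewrite inE.
exists g; split=> //.
  by apply/seteqP; split => [_ [k _ <-]|M /gsurj [k _ <-]]; [apply: gD | exists k].
move=> K KS Kc; have /finite_seqP [s sE] : finite_set (g @^-1` (D `&` K)).
  by apply: finite_preimage; [move=> k l _ _ /g_inj | exact: fin].
exists (\max_(k <- s) k).+1 => k lt_k Kgk.
have ks : [set` s] k by rewrite -sE; split=> //; apply: gD.
by move: lt_k; rewrite ltnNge (leq_bigmax_seq k).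
Qed.

End Topology.

(** * A one-parameter unipotent subgroup *)

Section Elementary.
Context {K : fieldType} {n : nat}.
Implicit Types (i j : 'I_n) (t : K).

Definition elem_mx i j t : 'M[K]_n := 1%:M + t *: delta_mx i j.

Lemma elem_mxE i j t k l : elem_mx i j t k l = (k == l)%:R + t * ((k == i) && (l == j))%:R.
Proof. by rewrite !mxE. Qed.

Lemma elem_mxM i j s t : i != j -> elem_mx i j s *m elem_mx i j t = elem_mx i j (s + t).
Proof.
move=> ij; rewrite /elem_mx mulmxDl mul1mx mulmxDr mulmx1 -scalemxAl -scalemxAr.
rewrite mul_delta_mx_cond eq_sym (negbTE ij) mulr0n !scaler0 addr0 scalerDl.
by rewrite -addrA [t *: _ + _]addrC.
Qed.

Lemma elem_mx0 i j : elem_mx i j 0 = 1%:M.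
Proof. by rewrite /elem_mx scale0r addr0. Qed.

Lemma det_elem_mx i j t : i != j -> \det (elem_mx i j t) = 1.
Proof.
have lower (k l : 'I_n) : (l < k)%N -> \det (elem_mx k l t) = 1.
  move=> lk; rewrite det_trig.
    apply: big1 => a _; rewrite elem_mxE eqxx /=.
    case: eqP => [->|_]; last by rewrite mulr0 addr0.
    by rewrite -val_eqE /= (gtn_eqF lk) mulr0 addr0.
  apply/is_trig_mxP => a b ab; rewrite elem_mxE -!val_eqE /= (ltn_eqF ab) add0r.
  case: eqP => [ak|_]; last by rewrite mulr0.
  case: eqP => [bl|_]; last by rewrite mulr0.
  by move: ab; rewrite ak bl ltnNge (ltnW lk).
rewrite -val_eqE neq_ltn => /orP[ij|]; last exact: lower.
rewrite -det_tr (_ : _^T = elem_mx j i t) ?lower //.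
by apply/matrixP => a b; rewrite mxE !elem_mxE eq_sym andbC.
Qed.

Lemma elem_mxMr_entry i j t (M : 'M[K]_n) k l :
  (M *m elem_mx i j t) k l = M k l + t * M k i * (l == j)%:R.
Proof.
rewrite /elem_mx mulmxDr mulmx1 -scalemxAr !mxE (bigD1 i) //= big1 ?addr0 => [|a ai].
  by rewrite mxE eqxx /= mulrA.
by rewrite mxE (negbTE ai) mulr0.
Qed.

End Elementary.

Section RootSubgroup.
Context {K : numFieldType} {n : nat}.
Variables i0 j0 : 'I_n.
Hypothesis ij : i0 != j0.

Definition root_subgroup : set 'M[K]_n := range (elem_mx i0 j0).

(** Restricted to the subgroup, polynomials become univariate. *)
Lemma mxeval_elem_mx p : exists P : {poly K}, forall t, mxeval (elem_mx i0 j0 t) p = P.[t].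
Proof.
pose q k : {poly K} := (mxvec (1%:M : 'M[K]_n) 0 k)%:P + mxvec (delta_mx i0 j0 : 'M[K]_n) 0 k *: 'X.
exists (\sum_(m <- mpoly.msupp p) (mpoly.mcoeff m p)%:P *
   \prod_k q k ^+ mpoly.fun_of_multinom m k) => t.
rewrite /mxeval mpoly.mevalE horner_sum; apply: eq_bigr => m _.
rewrite hornerM hornerC horner_prod; congr (_ * _); apply: eq_bigr => k _.
rewrite horner_exp /q hornerD hornerC hornerZ hornerX; congr (_ ^+ _).
by case/mxvec_indexP: k => a b; rewrite !mxvecE !mxE mulrC.
Qed.

(** A univariate polynomial has finitely many roots; this makes the subgroup
    irreducible of dimension one. *)
Lemma root_subgroup_finiteI Z : zariski_closed Z -> ~ root_subgroup `<=` Z ->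
  finite_set (root_subgroup `&` Z).
Proof.
move=> [Q ->] /existsNP [_ /not_implyP [[t _ <-]]].
move=> /existsNP [p /not_implyP [Qp pt]]; have [P PE] := mxeval_elem_mx p.
have P0 : P != 0 by apply/eqP => P0; apply: pt; have := PE t; rewrite P0 horner0.
suff fin : finite_set [set s | root P s].
  apply: sub_finite_set (finite_image (elem_mx i0 j0) fin) => _ [[s _ <-] Zs].
  by exists s => //=; apply/eqP; rewrite -PE; apply: Zs.
apply: contrapT => infP; have [B sB leB] := infinite_set_fset (size P) infP.
have allB : all (root P) (finmap.enum_fset B) by apply/allP => s sin; apply: (sB s).
by have := max_poly_roots P0 allB (finmap.fset_uniq B); rewrite ltnNge leB.
Qed.

Lemma elem_mx_inj : injective (elem_mx i0 j0 : K -> 'M[K]_n).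
Proof.
move=> s t /matrixP /(_ i0 j0); rewrite !elem_mxE !eqxx /= !mulr1.
exact: addrI.
Qed.

Lemma root_subgroup_infinite : infinite_set root_subgroup.
Proof.
pose f (k : nat) := elem_mx i0 j0 (k%:R : K).
have f_inj : injective f by move=> k l /elem_mx_inj /eqP; rewrite eqr_nat => /eqP.
move=> fin; apply: infinite_nat.
rewrite (_ : setT = f @^-1` root_subgroup).
  by apply: finite_preimage fin => k l _ _ /f_inj.
by apply/seteqP; split=> // k _; exists k%:R.
Qed.

Lemma zariski_closed_root_subgroup : zariski_closed root_subgroup.
Proof.
pose Z (p : 'I_n * 'I_n) : set 'M[K]_n :=
  if p == (i0, j0) then setT else [set M | M p.1 p.2 = (1%:M : 'M[K]_n) p.1 p.2].
have -> : root_subgroup = \bigcap_p Z p.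
  apply/seteqP; split => [_ [t _ <-] [a b] _|M ZM].
    rewrite /Z; case: eqP => //= neq; rewrite elem_mxE !mxE.
    have [ai|_] := eqVneq a i0; last by rewrite mulr0 addr0.
    have [bj|_] := eqVneq b j0; last by rewrite mulr0 addr0.
    by case: neq; rewrite ai bj.
  exists (M i0 j0) => //; apply/matrixP => a b; rewrite elem_mxE.
  have := ZM (a, b) I; rewrite /Z -pair_eqE /pair_eq /=.
  have [-> /=|_] := eqVneq a i0; last by move=> /= ->; rewrite !mxE mulr0 addr0.
  have [-> _|_] := eqVneq b j0; last by move=> /= ->; rewrite !mxE mulr0 addr0.
  by rewrite (negbTE ij) add0r mulr1.
apply: zariski_closed_bigcap => p; rewrite /Z; case: eqP => _.
  by exists set0; apply/seteqP; split=> // M _ q [].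
have := zariski_closed_level (mxvec_index p.1 p.2) ((1%:M : 'M[K]_n) p.1 p.2).
by under eq_fun do rewrite mxvecE.
Qed.

Lemma zariski_irreducible_root_subgroup : zariski_irreducible root_subgroup.
Proof.
split=> [|Z1 Z2 Z1c Z2c AZ]; first by exists 1%:M, 0 => //; apply: elem_mx0.
apply: contrapT => /not_orP [/(root_subgroup_finiteI Z1c) f1 /(root_subgroup_finiteI Z2c) f2].
apply: root_subgroup_infinite; rewrite (_ : root_subgroup = root_subgroup `&` (Z1 `|` Z2)).
  by rewrite setIUr finite_setU.
by apply/esym/setIidPl.
Qed.

Lemma zariski_closed_finite_set (Z : set 'M[K]_n) : finite_set Z -> zariski_closed Z.
Proof.
move=> /finite_seqP [s ->]; elim: s => [|M s IH].
  exists [set 1]; apply/seteqP; split => [M|M /(_ 1 erefl)] /=; first by rewrite in_nil.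
  by rewrite mpoly.meval1 => /eqP; rewrite oner_eq0.
rewrite (_ : [set` M :: s] = [set M] `|` [set` s]).
  by apply: zariski_closedU => //; apply: zariski_closed1.
apply/seteqP; split => N /=; rewrite in_cons; first by move=> /orP[/eqP|]; [left | right].
by move=> [->|->]; rewrite ?eqxx ?orbT.
Qed.

Lemma finite_irreducible (Z : set 'M[K]_n) : finite_set Z -> zariski_irreducible Z ->
  exists M, Z = [set M].
Proof.
move=> Zfin [[M ZM] Zirr]; exists M.
have [|||ZM1|/(_ M ZM) [_]] := Zirr [set M] (Z `\ M).
- exact: zariski_closed1.
- by apply: zariski_closed_finite_set; apply: sub_finite_set Zfin; apply: subDsetl.
- by move=> N ZN; have [->|NM] := pselect (N = M); [left | right].
- by apply/seteqP; split => // N ->.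
by case.
Qed.

Lemma krull_dim_root_subgroup : krull_dim root_subgroup 1.
Proof.
split.
  exists (fun i => if i is 0 then [set 1%:M] else root_subgroup); split.
    case=> [|[|//]] _ /=; split=> //; first exact: zariski_closed1.
    - exact: zariski_irreducible1.
    - by move=> _ ->; exists 0 => //; apply: elem_mx0.
    - exact: zariski_closed_root_subgroup.
    - exact: zariski_irreducible_root_subgroup.
  case=> [|//] _ /=; split; first by move=> _ ->; exists 0 => //; apply: elem_mx0.
  move=> /(sub_finite_set) /(_ (finite_set1 _)); exact: root_subgroup_infinite.
move=> [|[|m]] Z // [Zc Zlt]; exfalso.
have [Z1c Z1irr Z1A] := Zc 1%N isT; have [_ [[M0 ZM0] _] _] := Zc 0%N isT.
have [_ _ Z2A] := Zc 2%N isT.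
have Z1fin : finite_set (Z 1%N).
  rewrite (_ : Z 1%N = root_subgroup `&` Z 1%N); last by apply/esym/setIidPr.
  apply: root_subgroup_finiteI => // AZ1.
  by have [_] := Zlt 1%N isT; apply; apply: subset_trans Z2A AZ1.
have [M Z1E] := finite_irreducible Z1fin Z1irr.
have [Z01 nZ10] := Zlt 0%N isT; apply: nZ10; rewrite Z1E => _ ->.
by have := Z01 M0 ZM0; rewrite Z1E => <-.
Qed.

Lemma algebraic_root_subgroup : algebraic_subgroup root_subgroup.
Proof.
split.
- exact: zariski_closed_root_subgroup.
- by move=> _ [t _ <-]; apply: det_elem_mx.
- by exists 0 => //; apply: elem_mx0.
- by move=> _ _ [s _ <-] [t _ <-]; exists (s + t) => //; rewrite elem_mxM.
move=> _ [t _ <-]; exists (- t) => //.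
have inv : elem_mx i0 j0 (- t) *m elem_mx i0 j0 t = 1%:M.
  by rewrite elem_mxM // addNr elem_mx0.
have tu : elem_mx i0 j0 t \in unitmx by rewrite unitmxE det_elem_mx ?unitr1.
by rewrite -[RHS]mul1mx -inv mulmxK.
Qed.

End RootSubgroup.

(** * Tame subsets of SL *)

Section Moving.
Context {R : realType}.

Lemma bil_pivot n (u v : 'I_n.+1 -> R) : u ord0 = 1 -> v ord0 = 1 ->
  exists P Q : 'M[R[i]]_n.+1, [/\ \det P = 1, \det Q = 1 &
    forall M, (P *m M *m Q) 0 0 = bil u v M].
Proof.
move=> u0 v0.
pose P : 'M[R[i]]_(1 + n) := block_mx 1%:M (\row_j (u (lift ord0 j))%:C) 0 1%:M.
pose Q : 'M[R[i]]_(1 + n) := block_mx 1%:M 0 (\col_j (v (lift ord0 j))%:C) 1%:M.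
have e0 : 0 = lshift n 0 :> 'I_(1 + n) by apply: val_inj.
have PE k : P 0 k = (u k)%:C.
  rewrite -(splitK k) e0.
  case: (fintype.split k) => l /=; last first.
    by rewrite block_mxEur mxE; congr ((u _)%:C); apply: val_inj.
  rewrite block_mxEul !ord1 mxE eqxx (_ : lshift n 0 = ord0) ?u0 //; exact: val_inj.
have QE k : Q k 0 = (v k)%:C.
  rewrite -(splitK k) e0.
  case: (fintype.split k) => l /=; last first.
    by rewrite block_mxEdl mxE; congr ((v _)%:C); apply: val_inj.
  rewrite block_mxEul !ord1 mxE eqxx (_ : lshift n 0 = ord0) ?v0 //; exact: val_inj.
have detP : \det P = 1 by rewrite det_ublock !det1 mul1r.
have detQ : \det Q = 1 by rewrite det_lblock !det1 mul1r.
exists P, Q; split; [exact: detP | exact: detQ | move=> M].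
rewrite mxE /bil exchange_big /=; apply: eq_bigr => j _.
rewrite mxE mulr_suml; apply: eq_bigr => i _.
by rewrite PE QE rmorphM /= mulrAC.
Qed.

(** Once one rank-one functional is injective and proper on a sequence, the
    sequence can be moved to any other with the same values at the corner. *)
Lemma move_sequence n (u v : 'I_n.+1 -> R) (g h : nat -> 'M[R[i]]_n.+1) :
    u ord0 = 1 -> v ord0 = 1 ->
    injective (fun k => bil u v (g k)) -> (forall k, bil u v (g k) != 0) ->
    (forall B : R, exists N, forall k, (N <= k)%N -> B <= cabs (bil u v (g k))) ->
    (forall k, SL _ _ (g k)) -> (forall k, SL _ _ (h k)) ->
    (forall k, h k 0 0 = bil u v (g k)) ->
  exists psi, automorphism (SL R[i] n.+1) psi /\ forall k, psi (g k) = h k.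
Proof.
move=> u0 v0 z_inj z0 z_infty gS hS hz.
have [P [Q [detP detQ PQ]]] := bil_pivot u0 v0.
have zfree : free_nodes (fun k => bil u v (g k)).
  by move=> w; apply: entire_interpolation.
have PgQS k : SL R[i] n.+1 (P *m g k *m Q) by apply: SL_mul.
have [psi [psiA psiE]] := @move_with_pivot R n _ (fun k => P *m g k *m Q) h zfree z0 PgQS hS
  (fun k => PQ (g k)) hz.
exists (psi \o (fun M => P *m M *m Q)); split; last by move=> k; apply: psiE.
by apply: automorphism_comp psiA; apply: mulmx_automorphism.
Qed.

Lemma SL_neq0 n (M : 'M[R[i]]_n.+1) : SL R[i] n.+1 M -> M != 0.
Proof.
rewrite /SL /mkset => detM; apply/eqP => M0; have := oner_neq0 R[i].
by rewrite -detM M0 det0 eqxx.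
Qed.

(** A functional that vanishes nowhere on this family is injective on the
    sequence (off-diagonal members) and nonzero on it (diagonal members). *)
Definition pair_family n (f : nat -> 'M[R[i]]_n.+1) (p : nat * nat) :=
  if p.1 == p.2 then f p.1 else f p.1 - f p.2.

Lemma pair_family_neq0 n (f : nat -> 'M[R[i]]_n.+1) p :
  injective f -> (forall k, SL _ _ (f k)) -> pair_family f p != 0.
Proof.
move=> f_inj fS; rewrite /pair_family; case: (eqVneq p.1 p.2) => [_|neq]; first exact: SL_neq0 (fS _).
by rewrite subr_eq0; apply: contra_neq neq => /f_inj.
Qed.

Lemma bil_pair_family n (u v : 'I_n.+1 -> R) (f : nat -> 'M[R[i]]_n.+1) :
    (forall p, bil u v (pair_family f p) != 0) ->
  injective (fun k => bil u v (f k)) /\ forall k, bil u v (f k) != 0.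
Proof.
move=> nz; split=> [k l eq_kl|k]; last by have := nz (k, k); rewrite /pair_family eqxx.
apply: contrapT => /eqP kl; have := nz (k, l).
by rewrite /pair_family /= (negbTE kl) bilB eq_kl subrr eqxx.
Qed.

(** The constant factor brings the parameter of the unipotent subgroup to the
    corner. *)
Definition corner_mx n (z : R[i]) : 'M[R[i]]_n.+2 := elem_mx 0 1 (z - 1) *m elem_mx 1 0 1.

Lemma corner_mx00 n z : corner_mx n z 0 0 = z.
Proof. by rewrite elem_mxMr_entry !elem_mxE !eqxx /= !(mulr0, mulr1, mul1r, add0r, addr0) addrC subrK. Qed.

Lemma corner_mx01 n z : corner_mx n z 0 1 = z - 1.
Proof. by rewrite elem_mxMr_entry !elem_mxE !eqxx /= !(mulr0, mulr1, mul1r, add0r, addr0). Qed.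

Lemma corner_mx_SL n z : SL R[i] n.+2 (corner_mx n z).
Proof. by rewrite /SL /= det_mulmx !det_elem_mx ?mulr1. Qed.

(** The growth [k / c (k, k)] demanded from the automorphism of the tameness
    hypothesis makes the values of the functional grow at least like [k]. *)
Lemma tame_to_root_subgroup n (D : set 'M[R[i]]_n.+2) :
    infinite_set D -> discrete_in (SL R[i] n.+2) D -> tame (SL R[i] n.+2) D ->
  exists phi, automorphism (SL R[i] n.+2) phi /\ phi @` D `<=` root_subgroup 0 1.
Proof.
move=> Dinf Ddisc Dtame; have [g [g_inj gD _]] := discrete_SL_enum Dinf Ddisc.
have gS k : SL R[i] n.+2 (g k) by apply: Ddisc.1; rewrite -gD; exists k.
have [c [c0 cP]] := @generic_functional_countable R n.+1 (nat * nat)%type.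
pose rank x := xget 0%N [set k | g k = x].
have rankK : cancel g rank.
  by move=> k; apply: g_inj; apply: (@xgetPex _ 0%N [set l | g l = g k]); exists k.
pose zeta x : R := (rank x)%:R / c (rank x, rank x).
have zeta0 x : D x -> 0 <= zeta x by move=> _; rewrite divr_ge0 // ltW.
have [phi [phiA phi_far]] := Dtame _ _ (exhaustion_mxabs n.+2) zeta0.
have [phi' [phiS phi'S phiK _ _]] := phiA.
pose f k := phi (g k).
have fS k : SL R[i] n.+2 (f k) by apply: phiS.
have f_inj : injective f.
  by move=> k l fkl; apply: g_inj; rewrite -[g k]phiK ?inE // -/(f k) fkl phiK ?inE.
have [u [v [u0 v0 uvP]]] := cP (pair_family f).
have [|z_inj z0] := @bil_pair_family _ u v f.
  move=> p; rewrite -cabs_gt0; apply: lt_le_trans (uvP p).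
  by rewrite mulr_gt0 // mxabs_gt0 // pair_family_neq0.
have z_infty (B : R) : exists N, forall k, (N <= k)%N -> B <= cabs (bil u v (f k)).
  exists (Num.bound `|B|) => k Bk; have := uvP (k, k); rewrite /pair_family eqxx /=.
  apply: le_trans; rewrite mulrC -ler_pdivrMr //.
  have Dg : D (g k) by rewrite -gD; exists k.
  apply: le_trans (phi_far _ Dg); rewrite /zeta rankK ler_pM2r ?invr_gt0 //.
  apply: le_trans (ler_norm B) _; apply: le_trans (ltW (archi_boundP (normr_ge0 B))) _.
  by rewrite ler_nat.
have [psi [psiA psiE]] := move_sequence u0 v0 z_inj z0 z_infty fS
  (fun k => corner_mx_SL n (bil u v (f k))) (fun k => corner_mx00 n (bil u v (f k))).
exists ((fun M => 1%:M *m M *m elem_mx 1 0 (-1)) \o (psi \o phi)); split.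
  apply: automorphism_comp; first exact: automorphism_comp phiA psiA.
  by apply: mulmx_automorphism; rewrite ?det1 ?det_elem_mx.
move=> _ [x Dx <-]; move: Dx; rewrite -gD => -[k _ <-] /=; rewrite -/(f k) psiE mul1mx /corner_mx.
rewrite -mulmxA elem_mxM // subrr elem_mx0 mulmx1.
by exists (bil u v (f k) - 1).
Qed.

(** The corner of the targets [h k] is imposed, but their entry (0, 1) is free and
    can be chosen beyond the bound [b k] on the sublevel set of [rho]. *)
Lemma curve_subset_tame n (D A : set 'M[R[i]]_n.+2) phi :
    infinite_set D -> discrete_in (SL R[i] n.+2) D -> zariski_closed A ->
    (forall m (Z : nat -> set 'M[R[i]]_n.+2), krull_chain A m Z -> (m <= 1)%N) ->
    automorphism (SL R[i] n.+2) phi -> phi @` D `<=` A ->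
  tame (SL R[i] n.+2) D.
Proof.
move=> Dinf Ddisc Ac dimA phiA DA rho zeta [rhoc rho0 rhoK] zeta0.
have [g [g_inj gD g_escape]] := discrete_SL_enum Dinf Ddisc.
have Dg k : D (g k) by rewrite -gD; exists k.
have gS k : SL R[i] n.+2 (g k) by apply: Ddisc.1.
have [phi' [phiS phi'S phiK _ [_ phi'_hol]]] := phiA.
pose f k := phi (g k).
have fS k : SL R[i] n.+2 (f k) by apply: phiS.
have f_inj : injective f.
  by move=> k l fkl; apply: g_inj; rewrite -[g k]phiK ?inE // -/(f k) fkl phiK ?inE.
have f_escape (B : R) : exists N, forall k, (N <= k)%N -> B < mxabs (f k).
  pose K := SL R[i] n.+2 `&` [set M | mxabs M <= B].
  have Kc : compact K by have [_ _ cpt] := @exhaustion_mxabs R n.+2; exact: cpt B.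
  have imc : compact (phi' @` K).
    apply: continuous_compact Kc; have := holomorphic_on_continuous phi'_hol.
    by apply: continuous_subspaceW; apply: subIsetl.
  have [|N NP] := g_escape _ _ imc; first by move=> _ [M [MS _] <-]; apply: phi'S.
  exists N => k /NP far; rewrite ltNge; apply/negP => fB; apply: far.
  by exists (f k); [split | rewrite phiK ?inE].
have [u [v [u0 v0 uv0 [c [B [cpos cB]]]]]] := curve_proper_functional (pair_family f) Ac dimA.
have [|z_inj z0] := @bil_pair_family _ u v f.
  by move=> p; apply: uv0; apply: pair_family_neq0.
have z_infty (B' : R) : exists N, forall k, (N <= k)%N -> B' <= cabs (bil u v (f k)).
  have [N NP] := f_escape (Num.max B (B' / c)); exists N => k /NP.
  rewrite gt_max => /andP[Bk B'k].
  have Af : A (f k) by apply: DA; exists (g k).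
  apply: le_trans (cB _ Af Bk); rewrite mulrC -ler_pdivrMr //; exact: ltW.
have /choice [b bP] k := compact_mxabs_bounded (rhoK (zeta (g k))).
pose z k := bil u v (f k).
pose h k := corner_mx n (z k) *m elem_mx 0 1 (((`|b k| + 1)%:C - z k + 1) / z k).
have h00 k : h k 0 0 = z k.
  by rewrite elem_mxMr_entry corner_mx00 /= mulr0 addr0.
have h01 k : h k 0 1 = (`|b k| + 1)%:C.
  rewrite elem_mxMr_entry corner_mx00 corner_mx01 eqxx mulr1 divfK; last exact: z0.
  by rewrite addrC addrA [_ + 1 + _]addrAC subrK addrK.
have hS k : SL R[i] n.+2 (h k).
  by rewrite /SL /= det_mulmx corner_mx_SL det_elem_mx ?mulr1.
have [psi [psiA psiE]] := move_sequence u0 v0 z_inj z0 z_infty fS hS h00.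
exists (psi \o phi); split; first exact: automorphism_comp phiA psiA.
move=> x; rewrite -gD => -[k _ <-] /=; rewrite -/(f k) psiE leNgt; apply/negP => rho_lt.
have : mxabs (h k) <= b k by apply: bP; split=> //=; apply: ltW.
have := cabs_le_mxabs (h k) 0 1; rewrite h01 cabs_real.
have := ler_norm (b k); have := normr_ge0 (b k); have := ler_norm (`|b k| + 1); lra.
Qed.

End Moving.

Theorem proposition12p2 (R : realType) (n : nat) (D : set 'M[R[i]]_n)
    (D_infinite : infinite_set D) (D_discrete : discrete_in (SL R[i] n) D) :
  tame (SL R[i] n) D <->
  exists (A : set 'M[R[i]]_n) (phi : 'M[R[i]]_n -> 'M[R[i]]_n),
    [/\ algebraic_subgroup A, zariski_connected A, krull_dim A 1,
        automorphism (SL R[i] n) phi & phi @` D `<=` A].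
Proof.
have SL1 (M : 'M[R[i]]_n) : (n <= 1)%N -> SL R[i] n M -> M = 1%:M.
  case: n M {D D_infinite D_discrete} => [|[|//]] M _; first by move=> _; apply/matrixP => -[].
  by rewrite /SL /= det_mx11 => M1; apply/matrixP => i j; rewrite !ord1 M1 mxE.
have [n_le1|] := leqP n 1.
  case: D_infinite; apply: sub_finite_set (finite_set1 (1%:M : 'M[R[i]]_n)) => M DM.
  by apply: SL1 => //; apply: D_discrete.1.
case: n D D_infinite D_discrete {SL1} => [|[|n]] // D Dinf Ddisc _; split.
  move=> Dtame; have [phi [phiA phiD]] := tame_to_root_subgroup Dinf Ddisc Dtame.
  exists (root_subgroup 0 1), phi; split=> //.
  - exact: algebraic_root_subgroup.
  - have [A0 Airr] := @zariski_irreducible_root_subgroup R[i] n.+2 0 1.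
    by split=> // Z1 Z2 Z1c Z2c AZ _; apply: Airr.
  - exact: krull_dim_root_subgroup.
move=> [A [phi [[Ac _ _ _ _] _ [_ dimA] phiA phiD]]].
exact: curve_subset_tame Ac dimA phiA phiD.
Qed.
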